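(* For every $n\ge1$ there is a bijection $\phi$ from the set of Dyck paths of semilength $n-1$ to itself such that for every $n$-LNakayama algebra $A$ with Dyck path $D$ and every $0\le i\le n-2$: (1) $S_i$ is $1$-regular if and only if $\phi(D)$ has a $1$-rise with $x$-coordinate $i$; (2) $S_i$ is $2$-regular if and only if $\phi(D)$ has a $2$-hill at position $i$.
   Context: Fix a field $\mathbb{F}$. An $n$-LNakayama algebra is $A=\mathbb{F}Q/I$ with $Q$ the linear quiver $0\to1\to\cdots\to n-1$ and $I$ admissible ($J^m\subseteq I\subseteq J^2$, $m\ge2$, $J$ the arrow ideal). Modules are finite-dimensional right modules; $S_i$ is the simple module at vertex $i$; Kupisch series $c_i=\dim_{\mathbb{F}} e_iA$. A simple module $S$ is $k$-regular if $\operatorname{pd}(S)=k$, $\operatorname{Ext}^i_A(S,A)=0$ for $0\le i<k$ and $\dim_{\mathbb{F}}\operatorname{Ext}^k_A(S,A)=1$. Lattice paths use horizontal steps $(x,y)\to(x,y+1)$ and vertical steps $(x,y)\to(x+1,y)$. A Dyck path of semilength $N$ goes from $(0,0)$ to $(N,N)$ staying in $y\ge x$; its area sequence is $c_k=h_k-k+1$ ($0\le k\le N$), $h_k$ the largest $y$ with $(k,y)$ on the path. The Dyck path of $A$ is the Dyck path of semilength $n-1$ whose area sequence is the Kupisch series of $A$. A $1$-rise with $x$-coordinate $i$ is a horizontal step $(i,y)\to(i,y+1)$ that is neither immediately preceded nor immediately followed by a horizontal step. A $2$-hill at position $i$ is a segment consisting of the steps $(i,i)\to(i,i+1)\to(i,i+2)\to(i+1,i+2)\to(i+2,i+2)$.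 *)

(* Defs.v *)
From HB Require Import structures.
From mathcomp Require Import all_boot all_order all_algebra all_field.

Set Implicit Arguments.
Unset Strict Implicit.
Unset Printing Implicit Defensive.

Import GRing.Theory.
Local Open Scope ring_scope.

(* Throughout, the linear quiver 0 -> 1 -> ... -> n has n.+1 vertices, so that
   its path algebra is never the zero ring; the corresponding Dyck paths have
   semilength n. *)

(** * The path algebra of the linear quiver *)

(* For i <= j there is exactly one path from i to j; it is encoded by (i, j). *)
Definition lpath (n : nat) : predArgType :=
  {p : 'I_n.+1 * 'I_n.+1 | (p.1 <= p.2)%N}.
HB.instance Definition _ n := SubType.on (lpath n).
HB.instance Definition _ n := Finite.on (lpath n).

Definition source n (p : lpath n) : 'I_n.+1 := (val p).1.
Definition target n (p : lpath n) : 'I_n.+1 := (val p).2.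
Definition path_length n (p : lpath n) : nat := (target p - source p)%N.

Definition lazy_path n (i : 'I_n.+1) : lpath n :=
  exist _ (i, i) (leqnn i).

Definition is_concat n (q r p : lpath n) : bool :=
  [&& target q == source r, source p == source q & target p == target r].

Definition pathalg (F : fieldType) (n : nat) : Type := {ffun lpath n -> F^o}.
(* Only the vector space structure is inherited: the ring structure of finite
   functions is pointwise. *)
HB.instance Definition _ F n :=
  Vector.copy (pathalg F n) {ffun lpath n -> F^o}.

Section PathAlgebra.
Variables (F : fieldType) (n : nat).
Implicit Types (x y z : pathalg F n) (p q r : lpath n) (i j : 'I_n.+1).

Definition pcoef x p : F := (x : {ffun lpath n -> F^o}) p.

Definition pvec p : pathalg F n := [ffun q => (q == p)%:R : F^o].

Definition pathalg_one : pathalg F n :=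
  [ffun p => (path_length p == 0%N)%:R : F^o].

Definition pathalg_mul x y : pathalg F n :=
  [ffun p => \sum_(qr : lpath n * lpath n | is_concat qr.1 qr.2 p)
               pcoef x qr.1 * pcoef y qr.2 : F^o].

(* Auxiliary embedding into square matrices, from which the ring axioms are
   transported. *)
Definition pathalg_mx x : 'M[F]_n.+1 :=
  \matrix_(i, j) oapp (pcoef x) 0 (insub (i, j)).

Lemma pathalg_mxE x p : pathalg_mx x (source p) (target p) = pcoef x p.
Proof. by rewrite mxE -surjective_pairing valK. Qed.

Lemma pathalg_mx0 x i j : ~~ (i <= j)%N -> pathalg_mx x i j = 0.
Proof. by move=> ij; rewrite mxE insubN. Qed.

Lemma pathalg_mx_inj : injective pathalg_mx.
Proof.
move=> x y eq_xy; apply/ffunP=> p.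
by rewrite -[LHS](pathalg_mxE x) eq_xy pathalg_mxE.
Qed.

Lemma pathalg_mx1 : pathalg_mx pathalg_one = 1%:M.
Proof.
apply/matrixP=> i j; have [ij | ij] := boolP (i <= j)%N.
  rewrite (pathalg_mxE pathalg_one (exist _ (i, j) ij)) /pcoef ffunE mxE.
  by rewrite /path_length /= subn_eq0 -val_eqE eqn_leq ij.
by rewrite pathalg_mx0 // mxE -val_eqE eqn_leq (negPf ij).
Qed.

Lemma pathalg_mxM x y :
  pathalg_mx (pathalg_mul x y) = pathalg_mx x *m pathalg_mx y.
Proof.
apply/matrixP=> i j; rewrite [RHS]mxE.
have [ij | ij] := boolP (i <= j)%N; last first.
  rewrite pathalg_mx0 // big1 // => k _.
  have [ik | ik] := boolP (i <= k)%N; last by rewrite pathalg_mx0 ?mul0r.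
  rewrite [X in _ * X]pathalg_mx0 ?mulr0 //.
  by apply: contra ij; apply: leq_trans.
pose p : lpath n := exist _ (i, j) ij.
rewrite (pathalg_mxE (pathalg_mul x y) p) /pcoef ffunE.
rewrite (partition_big (fun qr => target qr.1) xpredT) //=.
apply: eq_bigr => k _; have [ik | ik] := boolP (i <= k)%N; last first.
  rewrite [X in X * _]pathalg_mx0 // mul0r big1 // => -[q r] /=.
  case/andP=> /and3P[_ /eqP pq _] /eqP qk; case/negP: ik.
  by rewrite -qk [i]pq; apply: (valP q).
have [kj | kj] := boolP (k <= j)%N; last first.
  rewrite [X in _ * X]pathalg_mx0 // mulr0 big1 // => -[q r] /=.
  case/andP=> /and3P[/eqP qr _ /eqP pr] /eqP qk; case/negP: kj.
  by rewrite -qk [j]pr qr; apply: (valP r).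
pose q : lpath n := exist _ (i, k) ik; pose r : lpath n := exist _ (k, j) kj.
rewrite (pathalg_mxE x q) (pathalg_mxE y r) (big_pred1 (q, r)) //.
case=> -[[a b] /= ab] [[c d] /= cd]; rewrite /is_concat /source /target /=.
rewrite xpair_eqE -[X in _ = X && _]val_eqE -[X in _ = _ && X]val_eqE /=.
rewrite !xpair_eqE /=.
rewrite [i == a]eq_sym [j == d]eq_sym.
by have [->|] := eqVneq b k; rewrite ?andbF ?andbT //= [k == c]eq_sym andbCA.
Qed.

Lemma pathalg_mxD x y : pathalg_mx (x + y) = pathalg_mx x + pathalg_mx y.
Proof.
apply/matrixP=> i j; rewrite !mxE; case: insubP => [p _ _|_] /=.
  by rewrite /pcoef ffunE.
by rewrite addr0.
Qed.

Lemma pathalg_mxZ (c : F) x : pathalg_mx (c *: x) = c *: pathalg_mx x.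
Proof.
apply/matrixP=> i j; rewrite !mxE; case: insubP => [p _ _|_] /=.
  by rewrite /pcoef ffunE.
by rewrite mulr0.
Qed.

Fact pathalg_mulA : associative pathalg_mul.
Proof. by move=> x y z; apply: pathalg_mx_inj; rewrite !pathalg_mxM mulmxA. Qed.

Fact pathalg_mul1 : left_id pathalg_one pathalg_mul.
Proof.
by move=> x; apply: pathalg_mx_inj; rewrite pathalg_mxM pathalg_mx1 mul1mx.
Qed.

Fact pathalg_mulr1 : right_id pathalg_one pathalg_mul.
Proof.
by move=> x; apply: pathalg_mx_inj; rewrite pathalg_mxM pathalg_mx1 mulmx1.
Qed.

Fact pathalg_mulDl : left_distributive pathalg_mul +%R.
Proof.
move=> x y z; apply: pathalg_mx_inj.
by rewrite pathalg_mxM !pathalg_mxD !pathalg_mxM mulmxDl.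
Qed.

Fact pathalg_mulDr : right_distributive pathalg_mul +%R.
Proof.
move=> x y z; apply: pathalg_mx_inj.
by rewrite pathalg_mxM !pathalg_mxD !pathalg_mxM mulmxDr.
Qed.

Fact pathalg_one_neq0 : pathalg_one != 0.
Proof.
apply/eqP=> /(congr1 (fun x => pcoef x (lazy_path ord0))) /eqP.
by rewrite /pcoef !ffunE /path_length subnn oner_eq0.
Qed.

HB.instance Definition _ := GRing.Zmodule_isNzRing.Build (pathalg F n)
  pathalg_mulA pathalg_mul1 pathalg_mulr1 pathalg_mulDl pathalg_mulDr
  pathalg_one_neq0.

Fact pathalg_scaleAl (c : F) x y : c *: (x * y) = (c *: x) * y.
Proof.
by apply: pathalg_mx_inj; rewrite pathalg_mxZ !pathalg_mxM pathalg_mxZ scalemxAl.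
Qed.

Fact pathalg_scaleAr (c : F) x y : c *: (x * y) = x * (c *: y).
Proof.
by apply: pathalg_mx_inj; rewrite pathalg_mxZ !pathalg_mxM pathalg_mxZ scalemxAr.
Qed.

HB.instance Definition _ :=
  GRing.Lmodule_isLalgebra.Build F (pathalg F n) pathalg_scaleAl.
HB.instance Definition _ :=
  GRing.Lalgebra_isAlgebra.Build F (pathalg F n) pathalg_scaleAr.
HB.instance Definition _ := Algebra_isFalgebra.Build F (pathalg F n).

Definition arrows : {vspace pathalg F n} :=
  <<[seq pvec p | p <- enum (lpath n) & path_length p == 1%N]>>%VS.

Definition arrow_ideal : {vspace pathalg F n} :=
  ({: pathalg F n} * arrows * {: pathalg F n})%VS.

Lemma pcoefM_lazy x y i :
  pcoef (x * y) (lazy_path i) = pcoef x (lazy_path i) * pcoef y (lazy_path i).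
Proof.
rewrite /pcoef ffunE (big_pred1 (lazy_path i, lazy_path i)) // .
case=> -[[a b] /= ab] [[c d] /= cd]; rewrite /is_concat /source /target /=.
rewrite xpair_eqE -[X in _ = X && _]val_eqE -[X in _ = _ && X]val_eqE /=.
rewrite !xpair_eqE -!val_eqE /=; apply/and3P/andP => /= [[/eqP bc /eqP ia /eqP id]|].
  by move: ab cd => /=; rewrite bc -ia -id !eqn_leq => -> ->; rewrite !leqnn.
by case=> /andP[/eqP-> /eqP->] /andP[/eqP-> /eqP->].
Qed.

Definition pcoef_lfun p : 'Hom(pathalg F n, F^o) :=
  linfun (fun x => pcoef x p : F^o).

Lemma pcoef_lfunE p x : pcoef_lfun p x = pcoef x p.
Proof.
pose f x : F^o := pcoef x p.
have lf : linear f by move=> c u v; rewrite /f /pcoef !ffunE.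
pose mf := GRing.isLinear.Build F (pathalg F n) F^o *:%R f lf.
pose g : {linear pathalg F n -> F^o} := HB.pack f mf.
exact: (lfunE g).
Qed.

Lemma arrow_ideal_lazy x i : x \in arrow_ideal -> pcoef x (lazy_path i) = 0.
Proof.
pose f := pcoef_lfun (lazy_path i).
have fP y : (y \in lker f) = (pcoef y (lazy_path i) == 0).
  by rewrite memv_ker pcoef_lfunE.
suffices /subvP sJf: (arrow_ideal <= lker f)%VS by move/sJf; rewrite fP => /eqP.
have sQf: ({: pathalg F n} * arrows <= lker f)%VS.
  apply/prodvP=> u v _ Av; rewrite fP pcoefM_lazy.
  suffices /subvP/(_ v Av): (arrows <= lker f)%VS.
    by rewrite fP => /eqP->; rewrite mulr0.
  apply/span_subvP=> _ /mapP[p + ->]; rewrite mem_filter => /andP[/eqP p1 _].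
  rewrite fP /pcoef ffunE; have [def_p | _] := eqVneq (lazy_path i) p; last exact: eqxx.
  by rewrite -def_p /path_length subnn in p1.
apply/prodvP=> u v /(subvP sQf) + _.
by rewrite !fP pcoefM_lazy => /eqP->; rewrite mul0r.
Qed.

Definition admissible (I : {vspace pathalg F n}) : Prop :=
  exists2 m : nat, (2 <= m)%N & (arrow_ideal ^+ m <= I <= arrow_ideal ^+ 2)%VS.

End PathAlgebra.

(** * Finite-dimensional right modules *)

Record rmod (F : fieldType) (A : falgType F) := RMod {
  rmod_sort :> vectType F;
  ract : rmod_sort -> A -> rmod_sort;
  ract_linearl : forall a, linear (ract^~ a);
  ract_linearr : forall v, linear (ract v);
  ract1 : forall v, ract v 1 = v;
  ractM : forall v a b, ract v (a * b) = ract (ract v a) b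
}.

Section Modules.
Variables (F : fieldType) (A : falgType F).
Implicit Types M N P : rmod A.

Fact regular_act_linearl (a : A) : linear (fun v : A => v * a).
Proof. by move=> c u v; rewrite mulrDl scalerAl. Qed.

Fact regular_act_linearr (v : A) : linear (fun a : A => v * a).
Proof. by move=> c a b; rewrite mulrDr scalerAr. Qed.

Definition regular_rmod : rmod A :=
  @RMod F A A (fun v a => v * a) regular_act_linearl regular_act_linearr
    (@mulr1 A) (@mulrA A).

Definition ract_lfun M (a : A) : 'End(M) := linfun (fun v : M => ract v a).

Lemma ract_lfunE M a v : ract_lfun M a v = ract v a.
Proof.
pose f := [eta @ract F A M ^~ a]; have lf : linear f by apply: ract_linearl.
pose mf := GRing.isLinear.Build F M M *:%R f lf.
pose g : {linear M -> M} := HB.pack f mf.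
exact: (lfunE g).
Qed.

Lemma ractZ M v c a : ract v (c *: a) = c *: ract (v : M) a.
Proof.
pose f := ract v; have lf : linear f by apply: ract_linearr.
pose mf := GRing.isLinear.Build F A M *:%R f lf.
pose g : {linear A -> M} := HB.pack f mf.
exact: (linearZ_LR g).
Qed.

Lemma ract_sum M v (I : finType) (a : I -> A) :
  ract v (\sum_i a i) = \sum_i ract (v : M) (a i).
Proof.
pose f := ract v; have lf : linear f by apply: ract_linearr.
pose mf := GRing.isLinear.Build F A M *:%R f lf.
pose g : {linear A -> M} := HB.pack f mf.
exact: (linear_sum g).
Qed.

Lemma ract0r M v : ract (v : M) 0 = 0.
Proof. by rewrite -[X in ract _ X](scale0r 0) ractZ scale0r. Qed.

(* Hom_A(M, N), see mem_homA. *)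
Definition homA M N : {vspace 'Hom(M, N)} :=
  (\bigcap_(a <- vbasis {: A})
     lker (linfun (fun f : 'Hom(M, N) =>
                     (f \o ract_lfun M a)%VF - (ract_lfun N a \o f)%VF)))%VS.

Lemma mem_homA M N (f : 'Hom(M, N)) :
  f \in homA M N <-> forall v a, f (ract v a) = ract (f v) a.
Proof.
pose d a (f : 'Hom(M, N)) := (f \o ract_lfun M a)%VF - (ract_lfun N a \o f)%VF.
have dE a : linfun (d a) f = d a f.
  have ld : linear (d a).
    move=> c g h; rewrite /d comp_lfunDl comp_lfunDr -comp_lfunZl -comp_lfunZr.
    by rewrite scalerBr opprD addrACA.
  pose md := GRing.isLinear.Build F 'Hom(M, N) 'Hom(M, N) *:%R (d a) ld.
  pose g : {linear 'Hom(M, N) -> 'Hom(M, N)} := HB.pack (d a) md.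
  exact: (lfunE g).
have dP a : reflect (forall v, f (ract v a) = ract (f v) a)
                    (f \in lker (linfun (d a))).
  rewrite memv_ker dE subr_eq0; apply: (iffP eqP) => [/lfunP df v | df].
    by move: (df v); rewrite !comp_lfunE !ract_lfunE.
  by apply/lfunP=> v; rewrite !comp_lfunE !ract_lfunE.
split=> [fH v a | fH]; last first.
  rewrite /homA; elim/big_rec: _ => [|a U _ fU]; first exact: memvf.
  by rewrite memv_cap fU andbT; apply/dP.
have {}fH i : f \in lker (linfun (d (vbasis {: A})`_i)).
  have [lt_i | ge_i] := ltnP i (size (vbasis {: A})); last first.
    by rewrite nth_default //; apply/dP=> w; rewrite !ract0r linear0.
  by apply: (subvP _ _ fH); rewrite /homA (big_rem _ (mem_nth 0 lt_i)) capvSl.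
rewrite [a](coord_vbasis (memvf a)) !ract_sum linear_sum; apply: eq_bigr => i _.
by rewrite !ractZ linearZ; congr (_ *: _); apply/dP.
Qed.

Definition projective P : Prop :=
  forall M N (g : 'Hom(M, N)) (f : 'Hom(P, N)),
    g \in homA M N -> limg g = fullv -> f \in homA P N ->
  exists2 h : 'Hom(P, M), h \in homA P M & (g \o h)%VF = f.

Record proj_resolution M := ProjResolution {
  res_mod :> nat -> rmod A;
  res_diff : forall k, 'Hom(res_mod k.+1, res_mod k);
  res_aug : 'Hom(res_mod 0, M);
  res_projective : forall k, projective (res_mod k);
  res_diff_hom : forall k, res_diff k \in homA (res_mod k.+1) (res_mod k);
  res_aug_hom : res_aug \in homA (res_mod 0) M;
  res_aug_surj : limg res_aug = fullv;
  res_exact0 : limg (res_diff 0) = lker res_aug;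
  res_exact : forall k, limg (res_diff k.+1) = lker (res_diff k)
}.

Section Ext.
Variables (M N : rmod A) (P : proj_resolution M).

Definition codiff k : 'Hom('Hom(P k, N), 'Hom(P k.+1, N)) :=
  linfun (fun f : 'Hom(P k, N) => (f \o res_diff P k)%VF).

Lemma codiffE k f : codiff k f = (f \o res_diff P k)%VF.
Proof.
pose g (f : 'Hom(P k, N)) := (f \o res_diff P k)%VF.
have lg : linear g by move=> c u v; rewrite /g comp_lfunDl comp_lfunZl.
pose mg := GRing.isLinear.Build F 'Hom(P k, N) 'Hom(P k.+1, N) *:%R g lg.
pose h : {linear 'Hom(P k, N) -> 'Hom(P k.+1, N)} := HB.pack g mg.
exact: (lfunE h).
Qed.

Definition cocycles k : {vspace 'Hom(P k, N)} :=
  (homA (P k) N :&: lker (codiff k))%VS.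

Definition coboundaries k : {vspace 'Hom(P k, N)} :=
  match k with
  | 0 => 0%VS
  | j.+1 => (codiff j @: homA (P j) N)%VS
  end.

(* Coboundaries are cocycles, so this is the dimension of the quotient. *)
Definition cohom_dim k : nat := (\dim (cocycles k) - \dim (coboundaries k))%N.

End Ext.

(* dim_F Ext^k_A(M, N) = d. The cohomology of Hom_A(P, N) does not depend on
   the projective resolution P of M. *)
Definition ext_dim M N k d : Prop :=
  exists P : proj_resolution M, cohom_dim N P k = d.

Definition pd_le M k : Prop :=
  exists P : proj_resolution M, forall j, (k < j)%N -> \dim {: P j} = 0%N.

Definition pd_eq M k : Prop :=
  pd_le M k /\ forall j, (j < k)%N -> ~ pd_le M j.

Definition k_regular (k : nat) M : Prop :=
  [/\ pd_eq M k,
      forall j, (j < k)%N -> ext_dim M regular_rmod j 0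
    & ext_dim M regular_rmod k 1].

End Modules.

(** * LNakayama algebras *)

(* An algebra F Q / I with I admissible, given by the projection F Q -> A with
   kernel I. *)
Record LNakayama (F : fieldType) (n : nat) := MkLNakayama {
  lnak_alg :> falgType F;
  lnak_proj : 'AHom(pathalg F n, lnak_alg);
  lnak_surj : limg lnak_proj = fullv;
  lnak_adm : admissible (lker lnak_proj)
}.

Section LNakayama.
Variables (F : fieldType) (n : nat) (A : LNakayama F n).

Definition idem (i : 'I_n.+1) : A := lnak_proj A (pvec F (lazy_path i)).

Definition kupisch (i : 'I_n.+1) : nat := \dim (<[idem i]> * {: A})%VS.

Definition simple_char (i : 'I_n.+1) (a : A) : F :=
  pcoef ((lnak_proj A)^-1%VF a) (lazy_path i).

(* The choice of a preimage in the path algebra is irrelevant. *)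
Lemma simple_charE i x : simple_char i (lnak_proj A x) = pcoef x (lazy_path i).
Proof.
set y := (lnak_proj A)^-1%VF (lnak_proj A x).
have piy : lnak_proj A y = lnak_proj A x by rewrite limg_lfunVK ?memv_img ?memvf.
have [m _ /andP[_ /subvP sIJ]] := lnak_adm A.
have /sIJ : y - x \in lker (lnak_proj A).
  by rewrite memv_ker linearB /= piy subrr.
suffices /subvP sJ : (arrow_ideal F n ^+ 2 <= lker (pcoef_lfun F (lazy_path i)))%VS.
  by move/sJ; rewrite memv_ker linearB /= !pcoef_lfunE subr_eq0 => /eqP.
apply/prodvP=> u v Ju _; rewrite memv_ker pcoef_lfunE pcoefM_lazy.
by rewrite (arrow_ideal_lazy _ Ju) mul0r.
Qed.

Lemma lnak_projK a : lnak_proj A ((lnak_proj A)^-1%VF a) = a.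
Proof. by rewrite limg_lfunVK // lnak_surj memvf. Qed.

Fact simple_act_linearl i a : linear (fun v : F^o => v * simple_char i a : F^o).
Proof. by move=> c u v; rewrite mulrDl -scalerAl. Qed.

Fact simple_act_linearr i (v : F^o) : linear (fun a => v * simple_char i a : F^o).
Proof.
move=> c a b; rewrite /simple_char linearP /= -!pcoef_lfunE linearP /=.
by rewrite mulrDr -scalerAr.
Qed.

Fact simple_act1 i (v : F^o) : v * simple_char i 1 = v.
Proof.
rewrite -(rmorph1 (lnak_proj A)) simple_charE /pcoef ffunE /path_length.
by rewrite subnn mulr1.
Qed.

Fact simple_actM i (v : F^o) a b :
  v * simple_char i (a * b) = v * simple_char i a * simple_char i b.
Proof.
rewrite -[a]lnak_projK -[b]lnak_projK -rmorphM !simple_charE pcoefM_lazy.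
exact: mulrA.
Qed.

(* S_i: the one-dimensional module on which the lazy path at i acts as the
   identity and all other paths act as 0. *)
Definition simple_rmod (i : 'I_n.+1) : rmod A :=
  @RMod F A F^o (fun v a => v * simple_char i a)
    (simple_act_linearl i) (simple_act_linearr i)
    (simple_act1 i) (simple_actM i).

End LNakayama.

(** * Dyck paths *)

(* A lattice path is the sequence of its steps: true stands for the horizontal
   step (x, y) -> (x, y + 1) and false for the vertical step
   (x, y) -> (x + 1, y). *)
Definition lattice_path := seq bool.

(* The point (x, y) reached from (0, 0) after k steps. *)
Definition point (w : lattice_path) (k : nat) : nat * nat :=
  (count negb (take k w), count id (take k w)).

Definition is_dyck (N : nat) (w : lattice_path) : bool :=
  (point w (size w) == (N, N)) &&
  all (fun k => ((point w k).1 <= (point w k).2)%N) (iota 0 (size w).+1).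

Definition dyck (N : nat) : Type := {w : lattice_path | is_dyck N w}.

Definition steps (N : nat) (D : dyck N) : lattice_path := sval D.

Definition height (w : lattice_path) (k : nat) : nat :=
  \max_(j < (size w).+1 | (point w j).1 == k) (point w j).2.

Definition area (w : lattice_path) (k : nat) : nat := (height w k - k + 1)%N.

Definition one_rise (w : lattice_path) (i : nat) : Prop :=
  exists k, [/\ (k < size w)%N, nth false w k, (point w k).1 = i,
                (0 < k)%N -> ~~ nth false w k.-1
              & (k.+1 < size w)%N -> ~~ nth false w k.+1].

Definition two_hill (w : lattice_path) (i : nat) : Prop :=
  exists k, point w k = (i, i) /\
            take 4 (drop k w) = [:: true; true; false; false].

Definition is_dyck_path_of (F : fieldType) (n : nat) (A : LNakayama F n)
    (D : dyck n) : Prop :=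
  forall i : 'I_n.+1, area (steps D) i = kupisch A i.

(* Main.v *)
(** Let [h i] be the height of the Dyck path at x-coordinate [i]: in [A] the path
    from [i] to [j] is nonzero iff [j <= h i].  The simple module at [i] has the
    minimal projective presentation e_r A -> e_(i+1) A -> e_i A with r = h i + 1.
    Since End (e_k A) is the ground field, lifting it into an arbitrary
    projective resolution and back composes to the identity, so it is a retract
    of every resolution; this determines projective dimension and Ext.  For
    i < n one obtains that S_i is 1-regular iff h i = h (i+1) and i is not a value
    of h, and 2-regular iff h i = i+1 < n, h (i+1) = h (i+2) and i is not a value of h.

    Recording for each i < n whether h i < h (i+1) and whether i is a value of h
    turns Dyck paths into 2-coloured Motzkin paths whose doubly marked level steps
    lie above level 0.  The 1-regular simples are the unmarked level steps and
    the 2-regular simples are the peaks at level 0.  Replacing each arc of the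
    Motzkin path, together with the k doubly marked level steps directly below
    it, by a step +(k+1) and k+1 steps -1 gives a Lukasiewicz path, that is, the
    sequence of column sizes (shifted by -1) of a Dyck path; unmarked level steps
    become columns of size 1 and peaks at level 0 become 2-hills. *)

From HB Require Import structures.
Require Import Defs.
From mathcomp Require Import all_boot all_order all_algebra all_field.
From mathcomp Require Import zify.

Set Implicit Arguments.
Unset Strict Implicit.
Unset Printing Implicit Defensive.

(** * Dyck paths as column sequences *)

(** Column [i] consists of the horizontal steps at x-coordinate [i], followed by the vertical step
    that leaves it. *)
Definition col_word (a : seq nat) : seq bool :=
  flatten [seq rcons (nseq c true) false | c <- a].

Fixpoint word_cols (c : nat) (w : seq bool) : seq nat :=
  match w with
  | [::] => [::]
  | true :: w' => word_cols c.+1 w'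
  | false :: w' => c :: word_cols 0 w'
  end.

Fixpoint balanced (d : nat) (w : seq bool) : bool :=
  match w with
  | [::] => d == 0
  | true :: w' => balanced d.+1 w'
  | false :: w' => (0 < d) && balanced d.-1 w'
  end.

Fixpoint col_balanced (d : nat) (a : seq nat) : bool :=
  match a with
  | [::] => d == 0
  | c :: a' => (0 < d + c) && col_balanced (d + c).-1 a'
  end.

Lemma col_word_cons c a : col_word (c :: a) = nseq c true ++ false :: col_word a.
Proof. by rewrite /col_word /= cat_rcons. Qed.

Lemma col_word_cat a b : col_word (a ++ b) = col_word a ++ col_word b.
Proof. by rewrite /col_word map_cat flatten_cat. Qed.

Lemma size_col_word a : size (col_word a) = sumn a + size a.
Proof.
by elim: a => //= c a IH; rewrite col_word_cons size_cat size_nseq /= IH; lia.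
Qed.

Lemma count_negb_col_word a : count negb (col_word a) = size a.
Proof.
by elim: a => //= c a IH; rewrite col_word_cons count_cat count_nseq /= IH; lia.
Qed.

Lemma count_id_col_word a : count id (col_word a) = sumn a.
Proof.
by elim: a => //= c a IH; rewrite col_word_cons count_cat count_nseq /= IH; lia.
Qed.

Lemma balanced_nseq d c w : balanced d (nseq c true ++ w) = balanced (d + c) w.
Proof. by elim: c d => [|c IH] d; rewrite ?addn0 //= IH addSnnS. Qed.

Lemma balanced_col_word d a : balanced d (col_word a) = col_balanced d a.
Proof. by elim: a d => //= c a IH d; rewrite col_word_cons balanced_nseq /= IH. Qed.

Lemma word_cols_nseq c d w : word_cols d (nseq c true ++ w) = word_cols (d + c) w.
Proof. by elim: c d => [|c IH] d; rewrite ?addn0 //= IH addSnnS. Qed.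

Lemma col_wordK : cancel col_word (word_cols 0).
Proof. by elim=> //= c a IH; rewrite col_word_cons word_cols_nseq /= IH. Qed.

(** At the end of a balanced word the excess is 0, so the invariant [c <= d] leaves no horizontal
    step pending in the accumulator. *)
Lemma word_colsK_gen d c w : balanced d w -> c <= d ->
  col_word (word_cols c w) = nseq c true ++ w.
Proof.
elim: w d c => [|[] w IH] d c /=.
- by move/eqP->; rewrite leqn0 => /eqP->.
- by move=> bw cd; rewrite (IH d.+1) //=; elim: (c) => //= m ->.
- by case/andP=> d0 bw cd; rewrite col_word_cons (IH d.-1).
Qed.

Lemma word_colsK d w : balanced d w -> col_word (word_cols 0 w) = w.
Proof. by move=> bw; rewrite (word_colsK_gen bw). Qed.

Lemma balancedP d w : reflect
  ((forall k, k <= size w -> count negb (take k w) <= d + count id (take k w)) /\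
   count negb w = d + count id w) (balanced d w).
Proof.
apply: (iffP idP).
  elim: w d => [|[] w IH] d /=; first by move/eqP->.
    case/IH=> Hk ->; split; last by lia.
    by case=> [|k] //= /Hk; lia.
  case/andP=> d0 /IH[Hk ->]; split; last by lia.
  by case=> [|k] //= /Hk; lia.
elim: w d => [|[] w IH] d /= [Hk eqc]; first by lia.
  by apply: IH; split=> [k kw|]; [have /= := Hk k.+1 kw; lia | lia].
have d0 : 0 < d by have := Hk 1 isT; rewrite /= take0 /=; lia.
by rewrite d0; apply: IH; split=> [k kw|]; [have /= := Hk k.+1 kw; lia | lia].
Qed.

Lemma is_dyckE N w : is_dyck N w = balanced 0 w && (count id w == N).
Proof.
rewrite /is_dyck /point take_size xpair_eqE.
apply/andP/andP => [[/andP[/eqP n1 /eqP n2] /allP Hk] | [/balancedP[Hk eqc] /eqP n2]].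
  rewrite n2 eqxx; split=> //; apply/balancedP; split=> [k kw|]; last by rewrite n1 n2.
  by apply: (Hk k); rewrite mem_iota add0n ltnS.
rewrite n2 eqc n2 !eqxx; split=> //; apply/allP=> k.
by rewrite mem_iota add0n ltnS => /andP[_ /Hk].
Qed.

Lemma col_balanced_sum d a : col_balanced d a -> d + sumn a = size a.
Proof. by elim: a d => [|c a IH] d /=; [move/eqP-> | case/andP=> d0 /IH; lia]. Qed.

Lemma col_balanced_take d a k : col_balanced d a -> k <= size a ->
  k <= d + sumn (take k a).
Proof.
elim: a d k => [|c a IH] d [|k] //= /andP[d0 /IH ok] /ok; lia.
Qed.

Lemma col_balanced_take_lt a k : col_balanced 0 a -> k < size a ->
  k < sumn (take k.+1 a).
Proof. by move=> ba ka; have := col_balanced_take ba ka. Qed.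

Lemma is_dyck_col_word a : col_balanced 0 a -> is_dyck (size a) (col_word a).
Proof.
move=> ba; rewrite is_dyckE balanced_col_word ba count_id_col_word.
by rewrite -(col_balanced_sum ba) eqxx.
Qed.

(** * Dyck paths identified with their column sequences *)

Section DyckCols.
Variable n : nat.
Implicit Type D : dyck n.

Definition dyck_cols D : seq nat := word_cols 0 (steps D).

Lemma dyck_colsK D : col_word (dyck_cols D) = steps D.
Proof. by have := svalP D; rewrite is_dyckE => /andP[/word_colsK]. Qed.

Lemma dyck_cols_balanced D : col_balanced 0 (dyck_cols D).
Proof.
rewrite -balanced_col_word dyck_colsK.
by have := svalP D; rewrite is_dyckE => /andP[].
Qed.

Lemma size_dyck_cols D : size (dyck_cols D) = n.
Proof.
rewrite -(col_balanced_sum (dyck_cols_balanced D)) -count_id_col_word dyck_colsK.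
by have := svalP D; rewrite is_dyckE => /andP[_ /eqP].
Qed.

Lemma dyck_cols_inj : injective dyck_cols.
Proof. by move=> D D' eqD; apply: val_inj; rewrite /= -[LHS]dyck_colsK eqD dyck_colsK. Qed.

Definition dyck_of_cols a (ba : col_balanced 0 a) (sa : size a = n) : dyck n :=
  exist (fun w => is_dyck n w) (col_word a)
    (eq_ind _ (fun m => is_dyck m (col_word a)) (is_dyck_col_word ba) _ sa).

Lemma dyck_of_colsK a (ba : col_balanced 0 a) (sa : size a = n) :
  dyck_cols (dyck_of_cols ba sa) = a.
Proof. exact: col_wordK. Qed.

Lemma steps_size D : size (steps D) == n + n.
Proof.
rewrite -dyck_colsK size_col_word size_dyck_cols.
by have := col_balanced_sum (dyck_cols_balanced D); rewrite add0n size_dyck_cols => ->.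
Qed.

(** All paths have length [n + n], so [dyck n] is transported to a finite type of tuples, where
    injective self-maps are bijective. *)
Lemma dyck_inj_bij (f : dyck n -> dyck n) : injective f -> bijective f.
Proof.
move=> inj_f; pose T := {t : (n + n).-tuple bool | is_dyck n t}.
pose to D : T := exist (fun t : (n + n).-tuple bool => is_dyck n t)
  (Tuple (steps_size D)) (svalP D).
pose from (t : T) : dyck n := exist (fun w => is_dyck n w) (tval (sval t)) (svalP t).
have toK : cancel to from by move=> D; apply: val_inj.
have fromK : cancel from to by move=> t; apply: val_inj; apply: val_inj.
have [g fK gK] : bijective (to \o f \o from).
  apply: injF_bij; apply: inj_comp; last exact: can_inj fromK.
  by apply: inj_comp => //; exact: can_inj toK.
exists (from \o g \o to) => D /=; first by have /= := fK (to D); rewrite toK => ->.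
apply: (can_inj toK); exact: gK.
Qed.

End DyckCols.

(** * Heights, rises and hills in terms of column sizes *)

Lemma col_word_pos a k : count negb (take k (col_word a)) < size a ->
  let i := count negb (take k (col_word a)) in
  exists2 m, m <= nth 0 a i & k = size (col_word (take i a)) + m.
Proof.
elim: a k => [|c a IH] k //=; rewrite col_word_cons take_cat size_nseq.
case: (ltnP k c) => [kc _ | ck].
  by rewrite take_nseq ?count_nseq ?(ltnW kc) //=; exists k => //; apply: ltnW.
rewrite count_cat count_nseq mul0n add0n.
case: k {ck}(subnKC ck) => [|k]; first by move=> ?; exists 0 => //=; lia.
case E: (k.+1 - c) => [|j] ckE /=; first by exists c => //=; lia.
rewrite add1n ltnS => /IH[m ma jE]; exists m => //.
by rewrite col_word_cons size_cat size_nseq add0n /=; lia.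
Qed.

Lemma count_id_take_col_word a k :
  count id (take k (col_word a)) <=
  sumn (take (count negb (take k (col_word a))).+1 a).
Proof.
elim: a k => [|c a IH] k //=; rewrite col_word_cons take_cat size_nseq.
case: (ltnP k c) => [kc | ck].
  by rewrite take_nseq ?(ltnW kc) // !count_nseq /= take0 /=; lia.
rewrite !count_cat !count_nseq mul0n mul1n add0n.
case: (k - c) => [|j] /=; first by lia.
by have := IH j; rewrite add1n add0n /=; lia.
Qed.

Lemma height_col_word a i : i <= size a ->
  height (col_word a) i = sumn (take i.+1 a).
Proof.
move=> ia; apply/eqP; rewrite eqn_leq; apply/andP; split.
  apply/bigmax_leqP => j /eqP <- /=; exact: count_id_take_col_word.
(* The top of column [i], where the maximum is attained; for [i = size a] the default column size 0
   makes it the end of the word. *)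
pose k := size (col_word (take i a)) + nth 0 a i.
have ka : k < (size (col_word a)).+1.
  have sE : sumn a = sumn (take i a) + sumn (drop i a).
    by rewrite -sumn_cat cat_take_drop.
  rewrite ltnS /k !size_col_word sE size_takel //.
  move: ia; rewrite leq_eqVlt => /orP[/eqP ->|ia].
    by rewrite nth_default // take_size; lia.
  by rewrite (drop_nth 0 ia) /=; lia.
have pk : point (col_word a) k = (i, sumn (take i.+1 a)).
  rewrite /point /k; move: ia; rewrite leq_eqVlt => /orP[/eqP ->|ia].
    rewrite nth_default // take_size addn0 take_size.
    by rewrite count_negb_col_word count_id_col_word take_oversize.
  have -> : col_word a = col_word (take i a) ++
      nseq (nth 0 a i) true ++ false :: col_word (drop i.+1 a).
    by rewrite -{1}(cat_take_drop i a) (drop_nth 0 ia) col_word_cat col_word_cons.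
  rewrite take_cat ltnNge leq_addr addKn /= take_cat size_nseq ltnn subnn take0.
  rewrite cats0 !count_cat count_negb_col_word count_id_col_word !count_nseq.
  by rewrite size_takel ?(ltnW ia) // (take_nth 0 ia) sumn_rcons mul0n mul1n addn0.
by case: pk => px py; apply: (bigmax_sup (Ordinal ka)); rewrite /= ?px ?py.
Qed.

Lemma one_rise_cons0 c a : one_rise (col_word (c :: a)) 0 <-> c = 1.
Proof.
rewrite col_word_cons; split=> [[k [kw wk xk k0 k1]] | ->]; last first.
  by exists 0; split.
have kc : k < c.
  rewrite ltnNge; apply/negP => ck; move: wk xk; rewrite /point.
  rewrite take_cat nth_cat size_nseq ltnNge ck /= count_cat count_nseq mul0n.
  by case: (k - c).
case: k k0 k1 kc {wk xk} kw => [_ k1 kc kw | k k0 _ kc _].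
  by move: c kc kw k1 => [|[|c]] //= _ _ /(_ isT).
by have := k0 isT; rewrite /= nth_cat size_nseq nth_nseq (ltnW kc).
Qed.

Lemma one_rise_consS c a i :
  one_rise (col_word (c :: a)) i.+1 <-> one_rise (col_word a) i.
Proof.
rewrite col_word_cons; set w := col_word a.
have nthE j : nth false (nseq c true ++ false :: w) (c.+1 + j) = nth false w j.
  rewrite nth_cat size_nseq ltnNge (leq_trans (leqnSn c)) ?leq_addr //=.
  by rewrite addSnnS addKn.
have ptE j : (point (nseq c true ++ false :: w) (c.+1 + j)).1 = (point w j).1.+1.
  rewrite /point /= take_cat size_nseq ltnNge (leq_trans (leqnSn c)) ?leq_addr //=.
  by rewrite addSnnS addKn count_cat count_nseq /= add1n.
have szE : size (nseq c true ++ false :: w) = c.+1 + size w.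
  by rewrite size_cat size_nseq /=; lia.
split=> [[k [kw wk xk k0 k1]] | [k [kw wk xk k0 k1]]].
  have ck : c < k.
    rewrite ltnNge; apply/negP => kc; move: xk; rewrite /point take_cat size_nseq.
    case: ltngtP kc => // [kc _|-> _]; first by rewrite take_nseq ?(ltnW kc) // count_nseq.
    by rewrite subnn take0 cats0 count_nseq.
  move: (subnKC ck) kw wk xk k0 k1 => <-; set j := k - c.+1.
  rewrite szE nthE ptE -addnS ?ltn_add2l ?leq_add2l => kw wk [xk] k0 k1.
  exists j; split=> //; last by move=> jw; have := k1 jw; rewrite nthE.
  by case: (j) k0 => // m; rewrite addnS /= -addSn nthE => /(_ isT).
exists (c.+1 + k); rewrite szE ptE xk nthE ltn_add2l; split=> // [_|].
  case: k k0 {kw wk xk k1} => [|k] k0.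
    by rewrite addn0 /= nth_cat size_nseq ltnn subnn.
  by rewrite addnS /= -/(c.+1 + k) nthE; apply: k0.
by rewrite -addnS ltn_add2l nthE.
Qed.

Lemma one_rise_col_word a i : i < size a ->
  one_rise (col_word a) i <-> nth 0 a i = 1.
Proof.
elim: a i => [|c a IH] [|i] //= ia; first exact: one_rise_cons0.
by split=> [/one_rise_consS/IH | /IH H]; [apply | apply/one_rise_consS/H].
Qed.

Lemma two_hill_col_word a i : col_balanced 0 a -> i < size a ->
  two_hill (col_word a) i <->
  [/\ sumn (take i a) = i, nth 0 a i = 2, nth 0 a i.+1 = 0 & i.+1 < size a].
Proof.
move=> ba ia.
have wE : col_word a = col_word (take i a) ++
    nseq (nth 0 a i) true ++ false :: col_word (drop i.+1 a).
  by rewrite -{1}(cat_take_drop i a) (drop_nth 0 ia) col_word_cat col_word_cons.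
have takeE m : take (size (col_word (take i a)) + m) (col_word a) =
    col_word (take i a) ++ take m (nseq (nth 0 a i) true ++ false :: col_word (drop i.+1 a)).
  by rewrite wE take_cat ltnNge leq_addr addKn.
have dropE m : drop (size (col_word (take i a)) + m) (col_word a) =
    drop m (nseq (nth 0 a i) true ++ false :: col_word (drop i.+1 a)).
  by rewrite wE drop_cat ltnNge leq_addr addKn.
split=> [[k [[xk yk] hk]] | [sa a2 a0 ia1]]; last first.
  exists (size (col_word (take i a))); rewrite -[size _]addn0 dropE /point takeE.
  rewrite take0 cats0 drop0 count_negb_col_word count_id_col_word sa a2.
  rewrite size_takel 1?ltnW //; split=> //.
  by rewrite (drop_nth 0 ia1) a0 col_word_cons /= take0.
have := @col_word_pos a k; rewrite xk => /(_ ia)[m ma kE].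
have /eqP : count id (take k (col_word a)) = i by [].
rewrite kE takeE count_cat count_id_col_word take_cat size_nseq => /eqP.
have -> : count id (if m < nth 0 a i then take m (nseq (nth 0 a i) true) else
    nseq (nth 0 a i) true ++ take (m - nth 0 a i) (false :: col_word (drop i.+1 a))) = m.
  case: ltngtP ma => // [ma _|-> _]; first by rewrite take_nseq ?(ltnW ma) // count_nseq mul1n.
  by rewrite subnn take0 cats0 count_nseq mul1n.
(* The point lies on the diagonal, and the first [i] columns already contain at least [i] horizontal
   steps; so the hill starts at the foot of column [i]. *)
have := col_balanced_take ba (ltnW ia); rewrite add0n => sa sm.
have m0 : m = 0 by lia.
move: hk; rewrite kE dropE m0 drop0.
case: (nth 0 a i) => [|[|[|c]]] //= [].
case: (ltnP i.+1 (size a)) => [ia1 | ai]; last by rewrite drop_oversize.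
rewrite (drop_nth 0 ia1) col_word_cons.
by case: (nth 0 a i.+1) => [|c] //= _; split=> //; lia.
Qed.

(** * Motzkin words and the bijection *)

Definition col_height (a : seq nat) (i : nat) : nat := sumn (take i.+1 a).

Definition col_heights (a : seq nat) : seq nat :=
  [seq col_height a i | i <- iota 0 (size a).+1].

(* The marks at i say whether the path has a peak with x-coordinate i + 1 and
   whether it has a peak with y-coordinate i. Exactly one mark is an up or a down
   step, none or both is a level step of a Motzkin path. *)
Definition peak_letter (a : seq nat) (i : nat) : bool * bool :=
  (col_height a i < col_height a i.+1, i \in col_heights a).

Definition peak_word (a : seq nat) : seq (bool * bool) :=
  [seq peak_letter a i | i <- iota 0 (size a)].

(** The test on [y] uses the level before the step, so it forbids doubly marked level steps at level
    0 as well. *)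
Fixpoint motzkin (d : nat) (w : seq (bool * bool)) : bool :=
  match w with
  | [::] => d == 0
  | (x, y) :: w' => (y ==> (0 < d)) && motzkin (d + x - y) w'
  end.

Definition rise_count (a : seq nat) (i : nat) : nat :=
  count (fun j => col_height a j < col_height a j.+1) (iota 0 i).

Definition height_count (a : seq nat) (y : nat) : nat :=
  count (mem (col_heights a)) (iota 0 y).

(** The Motzkin level after [i] letters; for balanced sequences and [i <= size a] the subtraction
    does not truncate, by [peak_word_level_ge]. *)
Definition peak_level (a : seq nat) (i : nat) : nat :=
  rise_count a i - height_count a i.

(** * The peak marks of a balanced sequence form a Motzkin word *)

Section PeakWord.
Variable a : seq nat.
Hypothesis a_bal : col_balanced 0 a.
Let n := size a.
Let h := col_height a.
Let Im := col_heights a.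

Lemma col_heightS i : h i.+1 = h i + nth 0 a i.+1.
Proof.
rewrite /h /col_height; case: (ltnP i.+1 n) => [ia|ai].
  by rewrite (take_nth 0 ia) sumn_rcons.
by rewrite nth_default // !take_oversize ?addn0 // ltnW.
Qed.

Lemma col_height_mono : {homo h : i j / i <= j}.
Proof. by apply: (homo_leq leqnn leq_trans) => i; rewrite col_heightS leq_addr. Qed.

Lemma col_height_size : h n = n.
Proof. by rewrite /h /col_height take_oversize //; have := col_balanced_sum a_bal. Qed.

Lemma col_height_gt i : i < n -> i < h i.
Proof. exact: col_balanced_take_lt. Qed.

Lemma col_height_le i : i <= n -> h i <= n.
Proof. by move/col_height_mono; rewrite col_height_size. Qed.

Lemma mem_col_heights i : i <= n -> h i \in Im.
Proof. by move=> le_in; apply: map_f; rewrite mem_iota. Qed.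

Lemma col_heightsP y : reflect (exists2 i, i <= n & h i = y) (y \in Im).
Proof.
apply: (iffP mapP) => [[i]|[i le_in <-]]; last by exists i; rewrite // mem_iota.
by rewrite mem_iota add0n ltnS => /andP[_ le_in] ->; exists i.
Qed.

Let cx := rise_count a.
Let cy := height_count a.

Let cxS i : cx i.+1 = cx i + (h i < h i.+1).
Proof. by rewrite /cx /rise_count -[i.+1 in LHS]addn1 iotaD count_cat /= add0n addn0. Qed.

Let cyS y : cy y.+1 = cy y + (y \in Im).
Proof. by rewrite /cy /height_count -[y.+1 in LHS]addn1 iotaD count_cat /= add0n addn0. Qed.

Let cy_mono : {homo cy : y z / y <= z}.
Proof. by apply: (homo_leq leqnn leq_trans) => i; rewrite cyS leq_addr. Qed.

Let cy_gap y z : (forall t, y < t -> t <= z -> t \notin Im) -> y <= z ->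
  cy z.+1 = cy y.+1.
Proof.
move=> gap; elim: z gap => [|z IH] gap; first by rewrite leqn0 => /eqP->.
rewrite leq_eqVlt => /orP[/eqP<-//|]; rewrite ltnS => yz.
rewrite cyS (negbTE (gap _ _ _)) ?addn0 ?ltnS // IH // => t yt tz.
by apply: gap => //; exact: leqW.
Qed.

(* Both sides count the distinct values among h 0, ..., h i. *)
Lemma count_heights i : i <= n -> cy (h i).+1 = (cx i).+1.
Proof.
elim: i => [|i IH] le_in.
  rewrite cyS mem_col_heights // addn1; congr _.+1.
  apply/eqP; rewrite -[cx 0]/0 -leqn0 leqNgt -has_count.
  apply/hasPn=> y; rewrite mem_iota add0n => /andP[_ yh].
  apply/negP=> /col_heightsP[j _ hj]; have := col_height_mono (leq0n j).
  by rewrite hj leqNgt yh.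
have := col_height_mono (leqnSn i); rewrite leq_eqVlt cxS.
case/orP=> [/eqP hE | hlt]; first by rewrite -hE ltnn addn0 IH // ltnW.
rewrite hlt addn1 -(IH (ltnW le_in)) cyS mem_col_heights // addn1.
case hiE: (h i.+1) hlt => [|z] //; rewrite ltnS => hz.
congr _.+1; apply: cy_gap => // t ht tz.
apply/negP=> /col_heightsP[j _ hj]; case: (leqP j i) => [/col_height_mono|].
  by rewrite hj leqNgt ht.
by move/col_height_mono; rewrite hiE hj ltnNge tz.
Qed.

Lemma count_height i : i <= n -> cy (h i) = cx i.
Proof.
by move=> le_in; have := count_heights le_in; rewrite cyS mem_col_heights // addn1 => -[].
Qed.

(** A value of [h] is determined by its rank, the number of smaller values. *)
Lemma count_inj y z : y \in Im -> z \in Im -> cy y = cy z -> y = z.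
Proof.
wlog yz : y z / y <= z.
  move=> wl Iy Iz E; case: (leqP y z) => [/wl|/ltnW/wl H]; first exact.
  by rewrite [RHS]H.
move: yz; rewrite leq_eqVlt => /orP[/eqP-> //|/cy_mono]; rewrite cyS => lt Iy _ E.
by move: lt; rewrite Iy E addn1 ltnn.
Qed.

Lemma size_peak_word : size (peak_word a) = n.
Proof. by rewrite size_map size_iota. Qed.

Lemma nth_peak_word i : i < n -> nth (false, false) (peak_word a) i = peak_letter a i.
Proof. by move=> lt_in; rewrite (nth_map 0) ?size_iota // nth_iota. Qed.

Lemma drop_peak_word i : i < n ->
  drop i (peak_word a) = peak_letter a i :: drop i.+1 (peak_word a).
Proof.
by move=> lt_in; rewrite (drop_nth (false, false)) ?size_peak_word // nth_peak_word.
Qed.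

Lemma peak_word_level_ge i : i <= n -> cy i <= cx i.
Proof.
move=> le_in; rewrite -count_height //; apply: cy_mono.
move: le_in; rewrite leq_eqVlt => /orP[/eqP-> | /col_height_gt/ltnW //].
by rewrite col_height_size.
Qed.

Lemma peak_word_level_gt i : i < n -> i \in Im -> cy i < cx i.
Proof.
move=> lt_in Ii; rewrite -count_height ?(ltnW lt_in) //.
by have := cy_mono (col_height_gt lt_in); rewrite cyS Ii addn1.
Qed.

Lemma motzkin_drop_peak_word i : i <= n -> motzkin (peak_level a i) (drop i (peak_word a)).
Proof.
(* Downward induction on [i]: the induction variable is [n - i], the number of letters left. *)
rewrite /peak_level -/cx -/cy => le_in; rewrite -(subKn le_in).
move: (leq_subr i n); move: (n - i) => {i le_in}.
elim=> [|k IH] le_kn.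
  rewrite subn0 drop_oversize ?size_peak_word //=.
  by rewrite -[X in cy X]col_height_size count_height ?subnn.
have lt_in : n - k.+1 < n by rewrite ltn_subrL; case: (n) le_kn.
have iE : n - k = (n - k.+1).+1 by rewrite -subSn.
have := IH (ltnW le_kn); rewrite iE; move: (n - k.+1) lt_in => i lt_in mo.
rewrite drop_peak_word //= -/h -/Im; apply/andP; split.
  by apply/implyP=> Ii; rewrite subn_gt0 peak_word_level_gt.
move: mo; rewrite cxS cyS; congr (is_true (motzkin _ _)).
by rewrite subnDA addnBAC ?peak_word_level_ge // ltnW.
Qed.

Lemma motzkin_peak_word : motzkin 0 (peak_word a).
Proof. by have := motzkin_drop_peak_word (leq0n n); rewrite drop0. Qed.

Lemma peak_word_flat i : i < n ->
  peak_letter a i = (false, false) <->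
  h i = h i.+1 /\ (forall j, j <= n -> h j <> i).
Proof.
move=> lt_in; rewrite /peak_letter -/h -/Im; split=> [[hh Ii]|[<- Ii]].
  split=> [|j le_jn hj]; last by rewrite -hj mem_col_heights in Ii.
  by apply/eqP; rewrite eqn_leq col_height_mono ?leqnSn // leqNgt hh.
by rewrite ltnn; congr pair; apply/negP=> /col_heightsP[j /Ii].
Qed.

Lemma peak_word_hill i : i < n ->
  [/\ peak_level a i = 0, peak_letter a i = (true, false),
      peak_letter a i.+1 = (false, true) & i.+1 < n] <->
  [/\ h i = i.+1, i.+2 <= n, h i.+1 = h i.+2 & forall j, j <= n -> h j <> i].
Proof.
move=> lt_in; rewrite /peak_level -/cx -/cy /peak_letter -/h -/Im; split.
  case=> /eqP; rewrite subn_eq0 => le_xy [_ Ii] [hh Ii1] lt_i1n.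
  have cE : cy i = cx i by apply/eqP; rewrite eqn_leq le_xy peak_word_level_ge // ltnW.
  split=> // [||j le_jn hj]; last by rewrite -hj mem_col_heights in Ii.
    (* At level 0, with [i] not a value, [h i] and [i.+1] have the same rank among the values of
       [h]. *)
    apply: count_inj => //; first by rewrite mem_col_heights // ltnW.
    by rewrite count_height 1?ltnW // cyS Ii addn0.
  by apply/eqP; rewrite eqn_leq col_height_mono ?leqnSn // leqNgt hh.
case=> hi lt_i1n hh Ii.
have nIi : i \in Im = false by apply/negP=> /col_heightsP[j /Ii].
have Ii1 : i.+1 \in Im by rewrite -hi mem_col_heights // ltnW.
rewrite -hh ltnn Ii1 nIi; split=> //.
  by have := count_height (ltnW lt_in); rewrite hi cyS nIi addn0 => ->; rewrite subnn.
by rewrite hi col_height_gt.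
Qed.

End PeakWord.

(** The marks determine the set of values of [h] and the counts [cx i]; [h i] is the value of rank
    [cx i], and the columns are its increments. *)
Lemma peak_word_inj a b : col_balanced 0 a -> col_balanced 0 b ->
  peak_word a = peak_word b -> a = b.
Proof.
move=> a_bal b_bal eq_ab.
have sz : size a = size b by rewrite -(size_peak_word a) eq_ab size_peak_word.
have letE i : i < size a -> peak_letter a i = peak_letter b i.
  by move=> ia; rewrite -nth_peak_word // eq_ab nth_peak_word -?sz.
have ImE y : y <= size a -> (y \in col_heights a) = (y \in col_heights b).
  rewrite leq_eqVlt => /orP[/eqP->|/letE[]//].
  rewrite -{1}(col_height_size a_bal) mem_col_heights //.
  by rewrite sz -(col_height_size b_bal) mem_col_heights.
have cxE i : i <= size a -> rise_count a i = rise_count b i.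
  move=> ia; apply: eq_in_count => j; rewrite mem_iota => /andP[_ ji].
  by case: (letE j (leq_trans ji ia)).
have cyE y : y <= size a -> height_count a y = height_count b y.
  move=> ya; apply: eq_in_count => j; rewrite mem_iota => /andP[_ ji].
  by apply: ImE; apply: leq_trans ya; exact: ltnW.
have hE i : i <= size a -> col_height a i = col_height b i.
  move=> ia; have ib : i <= size b by rewrite -sz.
  have hbi : col_height b i <= size a by rewrite sz col_height_le.
  apply: (count_inj (mem_col_heights ia)); first by rewrite ImE // mem_col_heights.
  by rewrite (cyE _ hbi) !count_height // cxE.
apply: (eq_from_nth (x0 := 0)) => // -[|i] ia.
  by have := hE 0 (leq0n _); rewrite /col_height; case: (a) (b) => [|? ?] [|? ?] //=;
     rewrite !take0 /= !addn0.
by have := hE i.+1 (ltnW ia); rewrite !col_heightS (hE i) ?(ltnW (ltnW ia)) // => /addnI.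
Qed.

(* The word is read from the right. Every open arc is a stack entry counting its
   down step and the doubly marked level steps directly below it; its up step
   becomes a column of that size plus one. The result is the pair of the stack
   and the column sizes. *)
Fixpoint unstack (w : seq (bool * bool)) : seq nat * seq nat :=
  match w with
  | [::] => ([::], [::])
  | l :: w' =>
    let: (s, v) := unstack w' in
    match l with
    | (false, false) => (s, 1 :: v)
    | (true, false) => (behead s, (head 0 s).+1 :: v)
    | (false, true) => (1 :: s, 0 :: v)
    | (true, true) => ((head 0 s).+1 :: behead s, 0 :: v)
    end
  end.

(** There is one stack entry per open arc, hence [d] of them. Each counts columns of size 0 whose
    steps -1 the arc still has to pay for, so the remaining Lukasiewicz path starts at the sum of
    the stack. *)
Lemma unstack_spec d w : motzkin d w ->
  [/\ size (unstack w).1 = d, all (leq 1) (unstack w).1,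
      col_balanced (sumn (unstack w).1) (unstack w).2
    & size (unstack w).2 = size w].
Proof.
elim: w d => [|[x y] w IH] d /=; first by move/eqP->.
case/andP=> yd /IH; case: (unstack w) => s v /= [sd ps bv sv].
case: x y yd sd => [] [] /= yd sd; case: s sd ps bv => [|k s] //= sd ps bv;
  rewrite ?sv ?ps ?addn0 ?add0n ?addn1 ?addnS /= ?[sumn s + k]addnC; split=> //;
  first [lia | by case/andP: ps | idtac].
Qed.

(** The first letter is recovered from column and stack: size 1 means unmarked, size at least 2 an
    up step, and size 0 a down step or a doubly marked step according to whether the top entry is 1
    or larger. *)
Lemma unstack_inj d e w u : motzkin d w -> motzkin e u ->
  unstack w = unstack u -> w = u.
Proof.
elim: w u d e => [|[x y] w IH] [|[x' y'] u] d e //=.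
- by case: (unstack u) => s v; case: x' y' => [] [].
- by case: (unstack w) => s v; case: x y => [] [].
case/andP=> yd mw /andP[yd' mu].
have [] := unstack_spec mw; have [] := unstack_spec mu.
move: (IH _ _ _ mw mu); case: (unstack w) (unstack u) => s v [t v'] /= IHw.
move=> szt pt _ _ szs ps _ _.
have {}IHw (l : bool * bool) : s = t -> v = v' -> l :: w = l :: u.
  by move=> st vv; rewrite IHw // st vv.
case: x y x' y' yd yd' szs szt {mw mu} => [] [] [] [] /= yd yd' szs szt;
  case: s t szs szt ps pt IHw => [|k s] [|m t] //= szs szt ps pt IHw; try lia;
  by case; move=> *; first [lia | apply: IHw; congruence].
Qed.

Lemma unstack_drop w i : (unstack (drop i w)).2 = drop i (unstack w).2.
Proof.
elim: w i => [|[x y] w IH] [|i]; rewrite ?drop0 //= IH.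
by case: (unstack w) => s v; case: x y => [] [].
Qed.

Lemma motzkin_unstack_cols w : motzkin 0 w ->
  col_balanced 0 (unstack w).2 /\ size (unstack w).2 = size w.
Proof. by case/unstack_spec => /eqP/nilP-> _. Qed.

Lemma unstack_cols_inj w u : motzkin 0 w -> motzkin 0 u ->
  (unstack w).2 = (unstack u).2 -> w = u.
Proof.
move=> mw mu eqc; apply: (unstack_inj mw mu).
rewrite [LHS]surjective_pairing [RHS]surjective_pairing eqc.
by case/unstack_spec: mw => /eqP/nilP-> _ _ _; case/unstack_spec: mu => /eqP/nilP->.
Qed.

Lemma unstack_col1 d l w : motzkin d (l :: w) ->
  (head 0 (unstack (l :: w)).2 == 1) = (l == (false, false)).
Proof.
case: l => x y /= /andP[yd /unstack_spec]; case: (unstack w) => s v /= [sd ps _ _].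
by case: x y yd sd => [] [] //=; case: s ps => [|[|k] s] //=; lia.
Qed.

(** An up step gets size 2 exactly when the top entry is 1; if the next column has size 0, that
    entry was just pushed by a down step, since a doubly marked step would leave at least 2. *)
Lemma unstack_col20 d l m w : motzkin d [:: l, m & w] ->
  d = 0 ->
  nth 0 (unstack [:: l, m & w]).2 0 = 2 /\ nth 0 (unstack [:: l, m & w]).2 1 = 0 <->
  l = (true, false) /\ m = (false, true).
Proof.
case: l m => x y [x' y'] /= /andP[yd /andP[yd' /unstack_spec]].
case: (unstack w) => s v /= [sd ps _ _] d0; subst d.
case: x y yd sd yd' => [] [] //= _; case: x' y' => [] [] //=;
  case: s ps => [|[|[|k]] [|k' s]] //=; try lia; move=> *; by split=> // -[].
Qed.

Lemma sumn_eq0_pos s : all (leq 1) s -> (sumn s == 0) = (size s == 0).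
Proof. by case: s => [|[|k] s]. Qed.

(** * The composite map on column sequences *)

Section PhiCols.
Variable a : seq nat.
Hypothesis a_bal : col_balanced 0 a.
Let n := size a.
Let b := (unstack (peak_word a)).2.

Lemma phi_cols_balanced : col_balanced 0 b.
Proof. by have [] := motzkin_unstack_cols (motzkin_peak_word a_bal). Qed.

Lemma size_phi_cols : size b = n.
Proof.
by have [_ ->] := motzkin_unstack_cols (motzkin_peak_word a_bal); rewrite size_peak_word.
Qed.

Lemma phi_cols_eq1 i : i < n -> nth 0 b i = 1 <->
  col_height a i = col_height a i.+1 /\ (forall j, j <= n -> col_height a j <> i).
Proof.
move=> lt_in; rewrite -(peak_word_flat lt_in).
have := motzkin_drop_peak_word a_bal (ltnW lt_in).
rewrite drop_peak_word // => /unstack_col1.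
rewrite -drop_peak_word // unstack_drop -nth0 nth_drop addn0 -/b => E.
by split=> /eqP eq1; apply/eqP; [rewrite -E | rewrite E].
Qed.

(** The excess [sumn (take i b) - i] equals the sum of the stack, whose entries are positive and as
    many as the level. *)
Lemma phi_cols_take i : i <= n -> sumn (take i b) = i <-> peak_level a i = 0.
Proof.
move=> le_in; have [<- ps bs _] := unstack_spec (motzkin_drop_peak_word a_bal le_in).
have := col_balanced_sum bs; rewrite unstack_drop size_drop -/b size_phi_cols.
have := col_balanced_sum phi_cols_balanced; rewrite -{1}(cat_take_drop i b) sumn_cat.
rewrite size_phi_cols; have := sumn_eq0_pos ps; move: (unstack _).1 => s.
by move=> E E1 E2; split=> [ti|/eqP]; [apply/eqP; rewrite -E | rewrite -E => /eqP]; lia.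
Qed.

Lemma phi_cols_hill i : i < n ->
  [/\ sumn (take i b) = i, nth 0 b i = 2, nth 0 b i.+1 = 0 & i.+1 < n] <->
  [/\ col_height a i = i.+1, i.+2 <= n, col_height a i.+1 = col_height a i.+2
    & forall j, j <= n -> col_height a j <> i].
Proof.
move=> lt_in; rewrite -(peak_word_hill a_bal lt_in).
have key : i.+1 < n -> peak_level a i = 0 -> nth 0 b i = 2 /\ nth 0 b i.+1 = 0 <->
    peak_letter a i = (true, false) /\ peak_letter a i.+1 = (false, true).
  move=> lt_i1n; have := motzkin_drop_peak_word a_bal (ltnW lt_in).
  rewrite drop_peak_word // drop_peak_word // => /unstack_col20.
  by rewrite -!drop_peak_word // unstack_drop !nth_drop addn0 addn1.
split=> [[/(phi_cols_take (ltnW lt_in)) l0 b2 b0 lt_i1n] | [l0 L R lt_i1n]].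
  by have [] := (key lt_i1n l0).1 (conj b2 b0).
have [? ?] := (key lt_i1n l0).2 (conj L R).
by split=> //; apply/(phi_cols_take (ltnW lt_in)).
Qed.

End PhiCols.

Lemma height_dyck n (D : dyck n) i : i <= n ->
  height (steps D) i = col_height (dyck_cols D) i.
Proof. by move=> le_in; rewrite -dyck_colsK height_col_word // size_dyck_cols. Qed.

(** The combinatorial half of the proof. Bijectivity comes from injectivity on a finite set; no
    inverse is constructed. *)
Theorem dyck_rise_hill_bijection n : exists phi : dyck n -> dyck n,
  bijective phi /\ forall (D : dyck n) i, i < n ->
    (one_rise (steps (phi D)) i <->
     height (steps D) i = height (steps D) i.+1 /\
     (forall j, j <= n -> height (steps D) j <> i)) /\
    (two_hill (steps (phi D)) i <->
     [/\ height (steps D) i = i.+1, i.+2 <= n,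
         height (steps D) i.+1 = height (steps D) i.+2
       & forall j, j <= n -> height (steps D) j <> i]).
Proof.
pose b D := (unstack (peak_word (@dyck_cols n D))).2.
have szb D : size (b D) = n by rewrite size_phi_cols ?size_dyck_cols ?dyck_cols_balanced.
have bb D : col_balanced 0 (b D) := phi_cols_balanced (dyck_cols_balanced D).
exists (fun D => dyck_of_cols (bb D) (szb D)); split.
  apply: dyck_inj_bij => D D' /(congr1 (@dyck_cols n)); rewrite !dyck_of_colsK => E.
  have bal := @dyck_cols_balanced n.
  apply/dyck_cols_inj/peak_word_inj => //.
  by apply: unstack_cols_inj E; apply: motzkin_peak_word.
move=> D i lt_in; have bal := dyck_cols_balanced D; have sz := size_dyck_cols D.
have hE j : j <= n -> height (steps D) j = col_height (dyck_cols D) j.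
  exact: height_dyck.
have hjE : (forall j, j <= n -> height (steps D) j <> i) <->
           (forall j, j <= n -> col_height (dyck_cols D) j <> i).
  by split=> H j le_jn; have := H j le_jn; rewrite hE.
have := phi_cols_eq1 bal; have := phi_cols_hill bal; rewrite sz => hillE riseE.
split.
  rewrite (one_rise_col_word (a := b D)) ?szb // riseE //.
  by rewrite (hE i (ltnW lt_in)) (hE i.+1 lt_in) hjE.
rewrite (two_hill_col_word (a := b D)) ?szb // hillE //.
rewrite (hE i (ltnW lt_in)) (hE i.+1 lt_in); split=> -[h1 h2 h3 h4]; split=> //.
- by rewrite hE.
- exact/hjE.
- by rewrite h3 hE.
- exact/hjE.
Qed.

Import GRing.Theory.
Local Open Scope ring_scope.

(** * Projective resolutions by modules eA *)

Lemma linfunE (F : fieldType) (U V : vectType F) (f : U -> V) :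
  linear f -> linfun f =1 f.
Proof.
move=> lf; pose mf := GRing.isLinear.Build F U V *:%R f lf.
pose g : {linear U -> V} := HB.pack f mf.
exact: (lfunE g).
Qed.

Lemma dim_add_line (F : fieldType) (V : vectType F) (U : {vspace V}) v :
  v \notin U -> \dim (U + <[v]>)%VS = (\dim U).+1.
Proof.
move=> vU; rewrite dimv_disjoint_sum ?dim_vline.
  by rewrite (_ : v != 0) ?addn1 //; apply: contraNneq vU => ->; exact: mem0v.
apply/eqP; rewrite -subv0; apply/subvP=> w; rewrite memv_cap => /andP[wU /vlineP[c wE]].
have [c0 | c0] := eqVneq c 0; first by rewrite wE c0 scale0r mem0v.
by case/negP: vU; rewrite -[v](scalerK c0) -wE memvZ.
Qed.

Lemma limg_dim0 (F : fieldType) (U V : vectType F) (f : 'Hom(U, V)) :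
  \dim {: U} = 0%N -> limg f = 0%VS.
Proof.
by move/eqP; rewrite dimv_eq0 => /eqP U0; rewrite U0 limg0.
Qed.

Section RightModules.
Variables (F : fieldType) (A : falgType F).
Implicit Types M N P Q : rmod A.

Lemma ractDl M (u v : M) a : ract (u + v) a = ract u a + ract v a.
Proof. by rewrite -!ract_lfunE linearD. Qed.

Lemma ractZl M c (v : M) a : ract (c *: v) a = c *: ract v a.
Proof. by rewrite -!ract_lfunE linearZ. Qed.

Lemma homAE M N (f : 'Hom(M, N)) : f \in homA M N ->
  forall v a, f (ract v a) = ract (f v) a.
Proof. by move/mem_homA. Qed.

Lemma homA_id M : \1%VF \in homA M M.
Proof. by apply/mem_homA => v a; rewrite !id_lfunE. Qed.

Lemma homA_comp M N P (f : 'Hom(N, P)) (g : 'Hom(M, N)) :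
  f \in homA N P -> g \in homA M N -> (f \o g)%VF \in homA M P.
Proof. by move=> Hf Hg; apply/mem_homA => v a; rewrite !comp_lfunE !homAE. Qed.

Section Submodule.
Variables (M : rmod A) (U : {vspace M}).
Hypothesis U_stable : forall v a, v \in U -> ract v a \in U.

Definition sub_act (v : subvs_of U) (a : A) : subvs_of U :=
  vsproj U (ract (vsval v) a).

Lemma sub_actE v a : vsval (sub_act v a) = ract (vsval v) a.
Proof. by rewrite vsprojK // U_stable // subvsP. Qed.

Fact sub_act_linearl a : linear (sub_act^~ a).
Proof.
by move=> c u v; apply: subvs_inj; rewrite !linearP /= !sub_actE linearP /= ractDl ractZl.
Qed.

Fact sub_act_linearr v : linear (sub_act v).
Proof.
by move=> c a b; apply: subvs_inj; rewrite linearP /= !sub_actE ract_linearr.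
Qed.

Fact sub_act1 v : sub_act v 1 = v.
Proof. by apply: subvs_inj; rewrite sub_actE ract1. Qed.

Fact sub_actM v a b : sub_act v (a * b) = sub_act (sub_act v a) b.
Proof. by apply: subvs_inj; rewrite !sub_actE ractM. Qed.

Definition sub_rmod : rmod A :=
  @RMod F A (subvs_of U) sub_act sub_act_linearl sub_act_linearr sub_act1 sub_actM.

Definition sub_val (x : sub_rmod) : M := vsval x.
Definition sub_in (x : M) : sub_rmod := vsproj U x.

Lemma sub_val_inj : injective sub_val.
Proof. exact: subvs_inj. Qed.

Lemma sub_valP x : sub_val x \in U.
Proof. exact: subvsP. Qed.

Lemma sub_inK x : x \in U -> sub_val (sub_in x) = x.
Proof. exact: vsprojK. Qed.

Lemma sub_val_act x a : sub_val (ract x a) = ract (sub_val x) a.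
Proof. exact: sub_actE. Qed.

Lemma sub_val_linear : linear sub_val.
Proof. by move=> c x y; rewrite /sub_val linearP. Qed.

Lemma sub_in_linear : linear sub_in.
Proof. by move=> c x y; rewrite /sub_in linearP. Qed.

End Submodule.

(** Since [projective] speaks of surjections, both maps are corestricted to the submodule
    [limg d]. *)
Lemma projective_lift P M N (d : 'Hom(M, N)) (f : 'Hom(P, N)) :
  projective P -> d \in homA M N -> f \in homA P N -> (limg f <= limg d)%VS ->
  exists2 h : 'Hom(P, M), h \in homA P M & (d \o h)%VF = f.
Proof.
move=> pP Hd Hf /subvP sfd.
have st v a : v \in limg d -> ract v a \in limg d.
  by case/memv_imgP=> w _ ->; rewrite -homAE // memv_img ?memvf.
pose N' := sub_rmod st.
pose cores (K : rmod A) (g : 'Hom(K, N)) : 'Hom(K, N') := linfun (fun v => sub_in st (g v)).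
have coresE (K : rmod A) (g : 'Hom(K, N)) v : g v \in limg d ->
    sub_val (cores K g v) = g v.
  move=> gv; rewrite /cores linfunE ?sub_inK // => c x y.
  by rewrite linearP sub_in_linear.
have cores_hom (K : rmod A) (g : 'Hom(K, N)) : g \in homA K N ->
    (forall v, g v \in limg d) -> cores K g \in homA K N'.
  move=> Hg gd; apply/mem_homA=> v a; apply: sub_val_inj.
  by rewrite sub_val_act !coresE // homAE.
have dd v : d v \in limg d by rewrite memv_img ?memvf.
have fd v : f v \in limg d by apply: sfd; rewrite memv_img ?memvf.
have [|h Hh hE] := pP M N' _ _ (cores_hom _ _ Hd dd) _ (cores_hom _ _ Hf fd).
  apply/eqP; rewrite eqEsubv subvf; apply/subvP=> w _.
  have /memv_imgP[v _ wv] := sub_valP w.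
  apply/memv_imgP; exists v; rewrite ?memvf //; apply: sub_val_inj.
  by rewrite coresE.
exists h => //; apply/lfunP=> v; rewrite comp_lfunE -(coresE _ d) // -(coresE _ f) //.
by rewrite -hE comp_lfunE.
Qed.

(* The rigidity of dP replaces a chain homotopy: it forces the lifts to compose
   to the identity. *)
Lemma comparison_step P (P' : rmod A) Q (Q' : rmod A) (dP : 'Hom(P, P')) (dQ : 'Hom(Q, Q'))
    (f' : 'Hom(P', Q')) (g' : 'Hom(Q', P')) :
  projective P -> projective Q -> dP \in homA P P' -> dQ \in homA Q Q' ->
  f' \in homA P' Q' -> g' \in homA Q' P' -> (g' \o f' = \1)%VF ->
  (limg (f' \o dP)%VF <= limg dQ)%VS -> (limg (g' \o dQ)%VF <= limg dP)%VS ->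
  (forall t, t \in homA P P -> (dP \o t = dP)%VF -> t = \1%VF) ->
  exists f : 'Hom(P, Q), exists g : 'Hom(Q, P),
    [/\ f \in homA P Q, g \in homA Q P, (dQ \o f = f' \o dP)%VF,
        (dP \o g = g' \o dQ)%VF & (g \o f = \1)%VF].
Proof.
move=> pP pQ HdP HdQ Hf' Hg' gf' sf sg rig.
have [f Hf fE] := projective_lift pP HdQ (homA_comp Hf' HdP) sf.
have [g Hg gE] := projective_lift pQ HdP (homA_comp Hg' HdQ) sg.
exists f, g; split=> //; apply: rig; first exact: homA_comp.
by rewrite comp_lfunA gE -comp_lfunA fE comp_lfunA gf' comp_lfun1l.
Qed.

(** Exactness supplies the image inclusions of [comparison_step]: by the commuting squares one
    degree lower, [f'] and [g'] carry kernels into kernels. *)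
Lemma comparison_next P (P' P'' : rmod A) Q (Q' Q'' : rmod A)
    (dP : 'Hom(P, P')) (dP' : 'Hom(P', P'')) (dQ : 'Hom(Q, Q')) (dQ' : 'Hom(Q', Q''))
    (f' : 'Hom(P', Q')) (g' : 'Hom(Q', P')) (f'' : 'Hom(P'', Q'')) (g'' : 'Hom(Q'', P'')) :
  projective P -> projective Q -> dP \in homA P P' -> dQ \in homA Q Q' ->
  f' \in homA P' Q' -> g' \in homA Q' P' -> (g' \o f' = \1)%VF ->
  (dQ' \o f' = f'' \o dP')%VF -> (dP' \o g' = g'' \o dQ')%VF ->
  limg dP = lker dP' -> limg dQ = lker dQ' ->
  (forall t, t \in homA P P -> (dP \o t = dP)%VF -> t = \1%VF) ->
  exists f : 'Hom(P, Q), exists g : 'Hom(Q, P),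
    [/\ f \in homA P Q, g \in homA Q P, (dQ \o f = f' \o dP)%VF,
        (dP \o g = g' \o dQ)%VF & (g \o f = \1)%VF].
Proof.
move=> pP pQ HdP HdQ Hf' Hg' gf' fE gE exP exQ; apply: comparison_step => //.
  rewrite exQ; apply/subvP=> _ /memv_imgP[v _ ->]; rewrite memv_ker comp_lfunE.
  rewrite -[dQ' _]comp_lfunE fE comp_lfunE (_ : dP' (dP v) = 0) ?linear0 //.
  by apply/eqP; rewrite -memv_ker -exP memv_img ?memvf.
rewrite exP; apply/subvP=> _ /memv_imgP[v _ ->]; rewrite memv_ker comp_lfunE.
rewrite -[dP' _]comp_lfunE gE comp_lfunE (_ : dQ' (dQ v) = 0) ?linear0 //.
by apply/eqP; rewrite -memv_ker -exQ memv_img ?memvf.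
Qed.

(** * The projective modules [eA] *)

Section PrincipalModule.
Variable e : A.

Lemma principal_stable (v : regular_rmod A) a :
  v \in limg (amull e) -> ract v a \in limg (amull e).
Proof.
case/memv_imgP=> y _ ->; apply/memv_imgP; exists (y * a); rewrite ?memvf //.
by rewrite !lfunE /= mulrA.
Qed.

Definition principal : rmod A := sub_rmod principal_stable.

Definition principal_in : A -> principal := sub_in principal_stable.

Definition principal_val : principal -> A := @sub_val _ _ principal_stable.

Lemma principal_val_inj : injective principal_val.
Proof. exact: sub_val_inj. Qed.

Lemma principal_inK x : e * x = x -> principal_val (principal_in x) = x.
Proof.
move=> ex; apply: (@sub_inK _ _ principal_stable); apply/memv_imgP; exists x; rewrite ?memvf //.
by rewrite lfunE.
Qed.

Lemma principal_act x a : principal_val (ract x a) = principal_val x * a.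
Proof. exact: (@sub_val_act _ _ principal_stable). Qed.

Lemma principal_val_linear : linear principal_val.
Proof. exact: (@sub_val_linear _ _ principal_stable). Qed.

Lemma principal_valZ c x : principal_val (c *: x) = c *: principal_val x.
Proof. exact: (linearZ_LR (HB.pack_for {linear principal -> A} principal_val
  (GRing.isLinear.Build F principal A *:%R principal_val principal_val_linear))). Qed.

Definition from_gen M (m : M) : 'Hom(principal, M) :=
  linfun (fun x : principal => ract m (principal_val x)).

Lemma from_genE M (m : M) x : from_gen m x = ract m (principal_val x).
Proof.
by rewrite linfunE // => c u v; rewrite principal_val_linear ract_linearr.
Qed.

Lemma from_gen_hom M (m : M) : from_gen m \in homA principal M.
Proof. by apply/mem_homA=> v a; rewrite !from_genE principal_act ractM. Qed.

Hypothesis e_idem : e * e = e.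

Lemma principal_valP x : e * principal_val x = principal_val x.
Proof.
have /memv_imgP[y _] := sub_valP x; rewrite -/(principal_val x) lfunE /= => ->.
by rewrite mulrA e_idem.
Qed.

Definition principal_gen : principal := principal_in e.

Lemma principal_genE : principal_val principal_gen = e.
Proof. exact: principal_inK. Qed.

Lemma act_principal_gen x : ract principal_gen (principal_val x) = x.
Proof.
by apply: principal_val_inj; rewrite principal_act principal_genE principal_valP.
Qed.

(** The image of the generator [e] determines the map; with [homA_gen_fix] and [from_gen] this
    identifies [Hom(eA, M)] with [Me]. *)
Lemma homA_genE M (f : 'Hom(principal, M)) x : f \in homA principal M ->
  f x = ract (f principal_gen) (principal_val x).
Proof. by move=> Hf; rewrite -homAE // act_principal_gen. Qed.

Lemma homA_gen_fix M (f : 'Hom(principal, M)) : f \in homA principal M ->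
  ract (f principal_gen) e = f principal_gen.
Proof. by move=> Hf; rewrite [RHS]homA_genE // principal_genE. Qed.

Lemma homA_gen_inj M (f g : 'Hom(principal, M)) : f \in homA principal M ->
  g \in homA principal M -> f principal_gen = g principal_gen -> f = g.
Proof.
by move=> Hf Hg fg; apply/lfunP=> x; rewrite (homA_genE x Hf) (homA_genE x Hg) fg.
Qed.

Lemma from_gen_gen M (m : M) : from_gen m principal_gen = ract m e.
Proof. by rewrite from_genE principal_genE. Qed.

Lemma principal_projective : projective principal.
Proof.
move=> M N g f Hg gsurj Hf.
have /memv_imgP[m _ mE] : f principal_gen \in limg g by rewrite gsurj memvf.
exists (from_gen m); first exact: from_gen_hom.
apply: homA_gen_inj => //; first exact: homA_comp (from_gen_hom m).
by rewrite comp_lfunE from_gen_gen homAE // -mE homA_gen_fix.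
Qed.

(** The corner [eAe] is the line through [e], so [t] is a scalar; as [d] is nonzero on the
    generator, the scalar is 1. *)
Lemma principal_rigid N (d : 'Hom(principal, N)) :
  (forall x, exists c, e * x * e = c *: e) -> d \in homA principal N ->
  d principal_gen != 0 ->
  forall t, t \in homA principal principal -> (d \o t = d)%VF -> t = \1%VF.
Proof.
move=> brick Hd dn0 t Ht dt; have [c cE] := brick (principal_val (t principal_gen)).
have tE : t principal_gen = c *: principal_gen.
  apply: principal_val_inj; rewrite principal_valZ principal_genE -cE.
  rewrite principal_valP -[RHS]principal_act.
  by rewrite homA_gen_fix.
apply: homA_gen_inj => //; first exact: homA_id.
rewrite id_lfunE tE; have /lfunP/(_ principal_gen) := dt.
rewrite comp_lfunE tE linearZ /= => /eqP; rewrite -subr_eq0 -{2}[d _]scale1r -scalerBl.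
by rewrite scaler_eq0 (negPf dn0) orbF subr_eq0 => /eqP->; rewrite scale1r.
Qed.

End PrincipalModule.

Lemma principal_val0 e : principal_val (0 : principal e) = 0.
Proof. by rewrite -(scale0r 0) principal_valZ scale0r. Qed.

Lemma principal_eq0 e (x : principal e) : (x == 0) = (principal_val x == 0).
Proof.
apply/eqP/eqP => [-> | x0]; first exact: principal_val0.
by apply: principal_val_inj; rewrite x0 principal_val0.
Qed.

Lemma principal0 (x : principal 0) : x = 0.
Proof. by apply/eqP; rewrite principal_eq0 -(principal_valP (mulr0 0) x) mul0r. Qed.

(** * Left multiplication by an element of [eAe'] as a map from [e'A] to [eA] *)

Section PrincipalMap.
Variables (e e' p : A).
Hypotheses (e_idem : e * e = e) (e'_idem : e' * e' = e').
Hypotheses (ep : e * p = p) (pe' : p * e' = p).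

Definition principal_map : 'Hom(principal e', principal e) :=
  from_gen e' (principal_in e p).

Lemma principal_mapE x : principal_val (principal_map x) = p * principal_val x.
Proof. by rewrite from_genE principal_act principal_inK. Qed.

Lemma principal_map_hom : principal_map \in homA (principal e') (principal e).
Proof. exact: from_gen_hom. Qed.

Lemma principal_map_gen : principal_val (principal_map (principal_gen e')) = p.
Proof. by rewrite principal_mapE principal_genE. Qed.

Lemma mem_limg_principal_map x :
  (x \in limg principal_map) <-> exists y, principal_val x = p * y.
Proof.
split=> [/memv_imgP[y _ ->] | [y xE]]; first by rewrite principal_mapE; exists (principal_val y).
apply/memv_imgP; exists (principal_in e' (e' * y)); rewrite ?memvf //.
apply: principal_val_inj; rewrite principal_mapE principal_inK ?mulrA ?e'_idem //.
by rewrite xE pe'.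
Qed.

Lemma mem_lker_principal_map x :
  (x \in lker principal_map) = (p * principal_val x == 0).
Proof. by rewrite memv_ker principal_eq0 principal_mapE. Qed.

Lemma homA_comp_principal_map M (f : 'Hom(principal e, M)) :
  f \in homA (principal e) M ->
  (f \o principal_map)%VF (principal_gen e') = ract (f (principal_gen e)) p.
Proof.
by move=> Hf; rewrite comp_lfunE (homA_genE e_idem _ Hf) principal_map_gen.
Qed.

End PrincipalMap.

(** * Resolutions by modules [eA] and their cochains *)

Section PrincipalResolution.
Variables (S : rmod A) (e p : nat -> A) (eps : 'Hom(principal (e 0%N), S)).
Hypotheses (e_idem : forall k, e k * e k = e k).
Hypotheses (ep : forall k, e k * p k = p k) (pe : forall k, p k * e k.+1 = p k).
Hypotheses (eps_hom : eps \in homA (principal (e 0%N)) S) (eps_surj : limg eps = fullv).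
Hypothesis eps_exact : limg (principal_map (e 0) (e 1) (p 0%N)) = lker eps.
Hypothesis exact_p :
  forall k x, e k.+1 * x = x -> p k * x = 0 <-> exists y, x = p k.+1 * y.

Fact principal_exact k : limg (principal_map (e k.+1) (e k.+2) (p k.+1)) =
  lker (principal_map (e k) (e k.+1) (p k)).
Proof.
apply/vspaceP=> x; have xP := principal_valP (e_idem k.+1) x.
rewrite mem_lker_principal_map //; apply/idP/eqP => [/mem_limg_principal_map[]// y xE|].
  by apply/exact_p => //; exists y.
by move/exact_p => -[]// y xE; apply/mem_limg_principal_map => //; exists y.
Qed.

Definition principal_resolution : proj_resolution S :=
  @ProjResolution F A S (fun k => principal (e k))
    (fun k => principal_map (e k) (e k.+1) (p k)) eps
    (fun k => principal_projective (e_idem k))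
    (fun k => principal_map_hom (e k) (e k.+1) (p k))
    eps_hom eps_surj eps_exact principal_exact.

Variable N : rmod A.

(** Evaluation at the generator turns cochains into elements of [N] fixed by [e k], and the
    codifferential into right multiplication by [p k]. *)
Lemma mem_principal_cocycles k (f : 'Hom(principal (e k), N)) :
  f \in cocycles N principal_resolution k <->
  f \in homA (principal (e k)) N /\ ract (f (principal_gen (e k))) (p k) = 0.
Proof.
rewrite /cocycles memv_cap memv_ker (codiffE (P := principal_resolution)) /=.
set d := principal_map _ _ _.
have Hd : d \in homA _ _ := principal_map_hom (e k) (e k.+1) (p k).
split=> [/andP[Hf /eqP df] | [Hf df]].
  split=> //; rewrite -(homA_comp_principal_map (e' := e k.+1)) // -/d df.
  by rewrite zero_lfunE.
rewrite Hf; apply/eqP/(homA_gen_inj (e_idem k.+1)); first exact: homA_comp Hd.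
  exact: mem0v.
by rewrite homA_comp_principal_map // zero_lfunE.
Qed.

Lemma mem_principal_coboundaries k (f : 'Hom(principal (e k.+1), N)) :
  f \in coboundaries N principal_resolution k.+1 <->
  f \in homA (principal (e k.+1)) N /\
  exists2 m, ract m (e k) = m & f (principal_gen (e k.+1)) = ract m (p k).
Proof.
have Hd : principal_map _ _ _ \in homA _ _ := principal_map_hom (e k) (e k.+1) (p k).
split=> [/memv_imgP[g Hg ->] | [Hf [m me fE]]].
  rewrite (codiffE (P := principal_resolution)) /=; split; first exact: homA_comp Hd.
  exists (g (principal_gen (e k))); first exact: homA_gen_fix.
  by rewrite homA_comp_principal_map.
apply/memv_imgP; exists (from_gen (e k) m); first exact: from_gen_hom.
rewrite (codiffE (P := principal_resolution)) /=; apply: (homA_gen_inj (e_idem k.+1)) => //.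
  exact: homA_comp (from_gen_hom _ _) Hd.
by rewrite homA_comp_principal_map ?from_gen_hom // from_gen_gen // me.
Qed.

End PrincipalResolution.

End RightModules.

(** * Linear Nakayama algebras *)

(** Downward closure makes the solutions of [P] an initial segment of the interval, so counting them
    gives its end. *)
Lemma count_prefix (P : pred nat) i L :
  (forall j k, i <= k <= j -> P j -> P k)%N ->
  forall j, (i <= j < i + L)%N -> P j = (j < i + count P (iota i L))%N.
Proof.
move=> Pdown; elim: L => [|L IH] j ij; first by lia.
rewrite -[L.+1]addn1 iotaD count_cat /= addn0.
have [PL | nPL] := boolP (P (i + L)%N).
  have allP k : k \in iota i L -> P k.
    by rewrite mem_iota => ik; apply: Pdown PL; lia.
  have -> : count P (iota i L) = L.
    by rewrite (eq_in_count (a2 := predT)) ?count_predT ?size_iota // => k /allP.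
  by rewrite (Pdown (i + L)%N) //; lia.
rewrite addn0; have [jL | jL] := ltnP j (i + L)%N; first by apply: IH; lia.
have -> : j = (i + L)%N by lia.
by have := count_size P (iota i L); rewrite size_iota (negPf nPL); lia.
Qed.

Section LinearNakayama.
Variables (F : fieldType) (n : nat) (A : LNakayama F n).

(** * Multiplication of paths in [A] *)

Lemma pathalg_mx_pvec (p : lpath n) :
  pathalg_mx (pvec F p) = delta_mx (source p) (target p).
Proof.
apply/matrixP=> i j; have [ij | ij] := boolP (i <= j)%N; last first.
  rewrite pathalg_mx0 // mxE; case: andP => // -[/eqP iE /eqP jE].
  by case/negP: ij; rewrite iE jE; apply: (valP p).
rewrite (pathalg_mxE (pvec F p) (exist _ (i, j) ij)) /pcoef ffunE mxE.
by rewrite -val_eqE /= [val p]surjective_pairing xpair_eqE.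
Qed.

Lemma pathalg_mx_zero : pathalg_mx (0 : pathalg F n) = 0.
Proof. by rewrite -(scale0r (0 : pathalg F n)) pathalg_mxZ scale0r. Qed.

(* The image in A of the path from i to j. It is 0 if j < i <= n or n < j; for
   j <= n < i it is a junk value. *)
Definition npath (i j : nat) : A :=
  oapp (fun p => lnak_proj A (pvec F p)) 0
    (if (j <= n)%N then insub (inord i, inord j) else None : option (lpath n)).

Lemma npath_lpath (p : lpath n) :
  npath (source p) (target p) = lnak_proj A (pvec F p).
Proof.
rewrite /npath -ltnS ltn_ord !inord_val -surjective_pairing.
by rewrite valK.
Qed.

Variant npath_spec (i j : nat) : A -> Prop :=
  | NPath p of source p = i :> nat & target p = j :> nat :
      npath_spec i j (lnak_proj A (pvec F p))
  | NoPath of ~~ (i <= j <= n)%N : npath_spec i j 0.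

Lemma npathP i j : (i <= n)%N -> npath_spec i j (npath i j).
Proof.
move=> le_in; have [/andP[ij jn] | nij] := boolP (i <= j <= n)%N.
  have lt_i : (i < n.+1)%N by []. have lt_j : (j < n.+1)%N by [].
  pose p : lpath n := exist (fun p : 'I_n.+1 * 'I_n.+1 => p.1 <= p.2)%N
    (Ordinal lt_i, Ordinal lt_j) ij.
  have -> : npath i j = lnak_proj A (pvec F p) by rewrite -npath_lpath.
  exact: NPath.
suff -> : npath i j = 0 by exact: NoPath.
rewrite /npath; case: (leqP j n) nij => //= jn; rewrite andbT => nij.
by rewrite insubN //= !inordK.
Qed.

Lemma npath0 i j : (i <= n)%N -> ~~ (i <= j <= n)%N -> npath i j = 0.
Proof.
move=> le_in; case: npathP => // p pi pj; rewrite -pi -pj (valP p) /=.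
by rewrite -ltnS ltn_ord.
Qed.

(** Paths embed as matrix units. The tests [i <= j] and [k <= l] matter: a factor with reversed
    indices is 0, although [npath i l] need not be. *)
Lemma npathM i j k l : (i <= n)%N -> (k <= n)%N -> npath i j * npath k l =
  if [&& j == k, i <= j & k <= l]%N then npath i l else 0.
Proof.
move=> le_in le_kn.
case: (npathP j le_in) => [p pi pj | nij]; last first.
  rewrite mul0r; case: ifP => // /and3P[/eqP jk ij _]; case/negP: nij.
  by rewrite ij jk.
case: (npathP l le_kn) => [q qk ql | nkl]; last first.
  rewrite mulr0; case: ifP => // /and3P[/eqP jk ij kl].
  by rewrite npath0 //; apply: contra nkl => /andP[_ ->]; rewrite kl.
rewrite -pi -pj -qk -ql -rmorphM /= (valP p) (valP q) !andbT.
have mE : pathalg_mx (pvec F p * pvec F q) =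
    delta_mx (source p) (target p) *m delta_mx (source q) (target q).
  by rewrite -!pathalg_mx_pvec -pathalg_mxM.
rewrite mul_delta_mx_cond in mE; rewrite val_eqE.
case: eqP mE => [pq | _] mE; last first.
  rewrite (_ : pvec F p * pvec F q = 0) ?linear0 //; apply: pathalg_mx_inj.
  by rewrite mE mulr0n pathalg_mx_zero.
have le_pq : (source p <= target q)%N.
  by rewrite (leq_trans (valP p)) // -/(target p) pq; apply: (valP q).
pose r : lpath n := exist (fun p : 'I_n.+1 * 'I_n.+1 => p.1 <= p.2)%N
  (source p, target q) le_pq.
rewrite (npath_lpath r); congr (lnak_proj A _); apply: pathalg_mx_inj.
by rewrite mE pathalg_mx_pvec.
Qed.

Lemma npath_sum1 : \sum_(i < n.+1) npath i i = 1.
Proof.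
rewrite -(rmorph1 (lnak_proj A)).
under eq_bigr => i _ do rewrite (npath_lpath (lazy_path i)).
rewrite -linear_sum /=; congr (lnak_proj A _); apply: pathalg_mx_inj.
rewrite [RHS]pathalg_mx1; apply/matrixP=> j k.
have [jk | jk] := boolP (j <= k)%N; last first.
  by rewrite pathalg_mx0 // mxE -val_eqE eqn_leq (negPf jk).
rewrite (pathalg_mxE _ (exist _ (j, k) jk)) /pcoef sum_ffunE.
rewrite [RHS]mxE (bigD1 j) //= big1 ?addr0 => [|i ij]; rewrite ffunE -val_eqE /= xpair_eqE.
  by rewrite eqxx eq_sym.
by rewrite eq_sym (negPf ij).
Qed.

(** Multiplying a matrix by diagonal units on both sides isolates one entry, which is 0 below the
    diagonal. So each corner of [A] is at most one-dimensional. *)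
Lemma npath_corner i j x : (i <= n)%N -> (j <= n)%N ->
  exists c, npath i i * x * npath j j = c *: npath i j.
Proof.
move=> le_in le_jn; rewrite -[x]lnak_projK; set X := (_^-1)%VF x.
case: (npathP i le_in) => [p pi pi' | ]; last by rewrite leqnn le_in.
case: (npathP j le_jn) => [q qj qj' | ]; last by rewrite leqnn le_jn.
have piE : source p = target p by apply: val_inj; rewrite /= pi pi'.
have qjE : source q = target q by apply: val_inj; rewrite /= qj qj'.
rewrite -!rmorphM /= -pi -qj'.
have mE : pathalg_mx (pvec F p * X * pvec F q) =
    pathalg_mx X (source p) (target q) *: delta_mx (source p) (target q).
  rewrite !pathalg_mxM !pathalg_mx_pvec -piE qjE; apply/matrixP=> a b.
  rewrite !mxE (bigD1 (target q)) //= big1 => [|c cq]; last first.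
    by rewrite [X in _ * X]mxE (negPf cq) mulr0.
  rewrite !mxE (bigD1 (source p)) //= big1 => [|c cq]; last first.
    by rewrite !mxE (negPf cq) andbF mul0r.
  by rewrite !mxE !eqxx /= !andbT !addr0 -mulrA mulrCA -natrM mulnb.
have [pq | pq] := boolP (source p <= target q)%N.
  pose r : lpath n := exist (fun p : 'I_n.+1 * 'I_n.+1 => p.1 <= p.2)%N
    (source p, target q) pq.
  exists (pathalg_mx X (source p) (target q)).
  rewrite (npath_lpath r) -linearZ /=; congr (lnak_proj A _); apply: pathalg_mx_inj.
  by rewrite pathalg_mxZ pathalg_mx_pvec mE.
exists 0; rewrite scale0r (_ : _ * _ = 0) ?linear0 //; apply: pathalg_mx_inj.
by rewrite mE (pathalg_mx0 _ pq) scale0r pathalg_mx_zero.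
Qed.

Lemma simple_char_npath (i : 'I_n.+1) j k : (j <= n)%N ->
  simple_char i (npath j k) = ((j == i) && (k == i))%:R.
Proof.
move=> le_jn; case: npathP => // [p pj pk | njk].
  rewrite simple_charE /pcoef ffunE -val_eqE /= [val p]surjective_pairing xpair_eqE.
  by rewrite -pj -pk eq_sym [X in _ && X]eq_sym -!val_eqE.
rewrite -(linear0 (lnak_proj A)) simple_charE /pcoef ffunE.
case: eqP njk => // ->; case: eqP => // ->.
by rewrite leqnn -ltnS ltn_ord.
Qed.

Lemma idem_npath (i : 'I_n.+1) : idem A i = npath i i.
Proof. by rewrite (npath_lpath (lazy_path i)). Qed.

Lemma npath_idem i : (i <= n)%N -> npath i i * npath i i = npath i i.
Proof. by move=> le_in; rewrite npathM // eqxx leqnn. Qed.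

Lemma npath_comp i j k : (i <= j <= k)%N -> (j <= n)%N -> npath i j * npath j k = npath i k.
Proof.
case/andP=> ij jk jn; rewrite npathM //; first by rewrite eqxx ij jk.
exact: leq_trans jn.
Qed.

Lemma npath_left i j : (i <= n)%N -> npath i i * npath i j = npath i j.
Proof.
move=> le_in; rewrite npathM // eqxx leqnn /=; case: leqP => // ji.
by rewrite npath0 //; apply/negP=> /andP[]; rewrite leqNgt ji.
Qed.

Lemma npath_right i j : (i <= n)%N -> (j <= n)%N -> npath i j * npath j j = npath i j.
Proof.
move=> le_in le_jn; rewrite npathM // eqxx leqnn andbT /=; case: leqP => // ji.
by rewrite npath0 //; apply/negP=> /andP[]; rewrite leqNgt ji.
Qed.

Lemma npath_suml x : x = \sum_(i < n.+1) npath i i * x.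
Proof. by rewrite -mulr_suml npath_sum1 mul1r. Qed.

Lemma npath_sumr x : x = \sum_(i < n.+1) x * npath i i.
Proof. by rewrite -mulr_sumr npath_sum1 mulr1. Qed.

Lemma mulr_exists_components r x :
  (forall j, (j <= n)%N -> exists y, x * npath j j = r * y) -> exists y, x = r * y.
Proof.
move=> Hx; have /fin_all_exists[y yE] : forall j : 'I_n.+1, exists y, x * npath j j = r * y.
  by move=> j; apply: Hx; rewrite -ltnS.
exists (\sum_j y j); rewrite mulr_sumr [LHS]npath_sumr.
by apply: eq_bigr => j _; exact: yE.
Qed.

Lemma mull_exists_components r x :
  (forall j, (j <= n)%N -> exists y, npath j j * x = y * r) -> exists y, x = y * r.
Proof.
move=> Hx; have /fin_all_exists[y yE] : forall j : 'I_n.+1, exists y, npath j j * x = y * r.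
  by move=> j; apply: Hx; rewrite -ltnS.
exists (\sum_j y j); rewrite mulr_suml [LHS]npath_suml.
by apply: eq_bigr => j _; exact: yE.
Qed.

Lemma npath_eq0_components x : (forall j, (j <= n)%N -> npath j j * x = 0) -> x = 0.
Proof.
by move=> Hx; rewrite [x]npath_suml big1 // => j _; apply: Hx; rewrite -ltnS.
Qed.

Lemma npath_row i j x : (i <= n)%N -> (j <= n)%N -> npath i i * x = x ->
  exists c, x * npath j j = c *: npath i j.
Proof. by move=> le_in le_jn <-; exact: npath_corner. Qed.

Lemma npath_col i j x : (i <= n)%N -> (j <= n)%N -> x * npath j j = x ->
  exists c, npath i i * x = c *: npath i j.
Proof. by move=> le_in le_jn <-; rewrite mulrA; exact: npath_corner. Qed.

Lemma npath_neq0_sub i k j : (i <= k <= j)%N -> npath i j != 0 -> (j <= n)%N ->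
  npath i k != 0.
Proof.
move=> ikj ne0 le_jn; apply: contraNneq ne0 => ik0.
by rewrite -(@npath_comp i k) ?ik0 ?mul0r //; lia.
Qed.

(** Right multiplication by the lazy path at [j] keeps the path ending at [j] and kills the
    others. *)
Lemma free_npath i s : (i <= n)%N -> uniq s -> all (fun j => npath i j != 0) s ->
  free [seq npath i j | j <- s].
Proof.
move=> le_in; elim: s => [|j s IH] /=; first by rewrite nil_free.
case/andP=> js us /andP[j0 s0]; rewrite free_cons IH // andbT.
have le_jn : (j <= n)%N.
  by move: j0; apply: contraNT => jn; rewrite npath0 // (negPf jn) andbF.
apply: contraNN j0 => jspan.
suff /subvP/(_ _ jspan) : (<<[seq npath i k | k <- s]>> <= lker (amulr (npath j j)))%VS.
  by rewrite memv_ker lfunE /= npath_right.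
apply/span_subvP=> _ /mapP[k ks ->]; rewrite memv_ker lfunE /= npathM //.
by case: (k =P j) => //= kj; rewrite -kj ks in js.
Qed.

Lemma kupisch_count (i : 'I_n.+1) :
  kupisch A i = count (fun j => npath i j != 0) (iota 0 n.+1).
Proof.
have le_in : (i <= n)%N by rewrite -ltnS.
pose s := [seq j <- iota 0 n.+1 | npath i j != 0].
have -> : kupisch A i = \dim <<[seq npath i j | j <- s]>>%VS.
  rewrite /kupisch idem_npath; congr (\dim _); apply/eqP; rewrite eqEsubv.
  apply/andP; split.
    apply/prodvP=> u x /vlineP[c ->] _; rewrite -scalerAl memvZ //.
    rewrite [_ * x]npath_sumr; apply: memv_suml => j _.
    have le_jn : (j <= n)%N by rewrite -ltnS.
    have [c' ->] := npath_corner x le_in le_jn; apply: memvZ.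
    have [-> | ne0] := eqVneq (npath i j) 0; first exact: mem0v.
    by apply: memv_span; apply: map_f; rewrite mem_filter ne0 mem_iota.
  apply/span_subvP=> _ /mapP[j _ ->]; rewrite -npath_left //.
  by rewrite memv_mul ?memv_line ?memvf.
have /eqP -> : free [seq npath i j | j <- s].
  apply: free_npath => //; first by rewrite filter_uniq ?iota_uniq.
  by apply/allP=> j; rewrite mem_filter => /andP[].
by rewrite size_map size_filter.
Qed.

(** Initial segments of nonzero paths are nonzero, so the targets reached from [i] form an interval
    starting at [i]; its length is the dimension of [e_i A]. *)
Lemma npath_neq0 (i : 'I_n.+1) j : (i <= j <= n)%N ->
  (npath i j != 0) = (j < i + kupisch A i)%N.
Proof.
move=> ijn; have le_in : (i <= n)%N by rewrite -ltnS.
rewrite kupisch_count; set P := fun j => _.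
have P_n k : P k -> (i <= k <= n)%N by rewrite /P; apply: contraNT => /(npath0 le_in)->.
rewrite (_ : iota 0 n.+1 = iota 0 i ++ iota i (n.+1 - i)); last first.
  by rewrite -iotaD; congr iota; lia.
rewrite count_cat (_ : count P (iota 0 i) = 0%N) ?add0n; last first.
  apply/eqP; rewrite -leqn0 leqNgt -has_count; apply/hasPn=> k.
  by rewrite mem_iota => ki; apply/negP=> /P_n; lia.
rewrite -[LHS]/(P j); apply: count_prefix; last by lia.
by move=> a b iba Pa; have /andP[_ /(npath_neq0_sub iba Pa)] := P_n _ Pa.
Qed.

Lemma simple_charM (i : 'I_n.+1) (a b : A) :
  simple_char i (a * b) = simple_char i a * simple_char i b.
Proof. by have := simple_actM i (1 : F^o) a b; rewrite !mul1r. Qed.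

Lemma simple_charZ (i : 'I_n.+1) c (a : A) : simple_char i (c *: a) = c * simple_char i a.
Proof. by rewrite /simple_char linearZ /= -!pcoef_lfunE linearZ. Qed.

Lemma npath_id_neq0 i : (i <= n)%N -> npath i i != 0.
Proof.
move=> le_in; have lt_i : (i < n.+1)%N by [].
apply/eqP=> /(congr1 (simple_char (Ordinal lt_i))).
rewrite simple_char_npath // eqxx /simple_char linear0 /pcoef ffunE => /eqP.
by rewrite oner_eq0.
Qed.

(** * The algebra described by the height function [h] of its nonzero paths *)

Variable h : nat -> nat.
Hypothesis hP : forall i j, (i <= j <= n)%N -> (npath i j != 0) = (j <= h i)%N.
Hypothesis h_gt : forall i, (i < n)%N -> (i < h i)%N.
Hypothesis h_mono : forall i j, (i <= j <= n)%N -> (h i <= h j)%N.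
Hypothesis h_le : forall i, (i <= n)%N -> (h i <= n)%N.

Lemma npath_beyond i j : (i <= n)%N -> (h i < j)%N -> npath i j = 0.
Proof.
move=> le_in hj; have [ijn | nij] := boolP (i <= j <= n)%N; last exact: npath0.
by apply/eqP/negPn; rewrite hP // -ltnNge.
Qed.

Lemma npath_scale_eq0 c i j : (i <= j <= n)%N -> (j <= h i)%N ->
  c *: npath i j = 0 -> c = 0.
Proof.
move=> ijn jh /eqP; rewrite scaler_eq0 => /orP[/eqP// | /eqP/eqP].
by rewrite -(negbK (_ == 0)) hP ?jh.
Qed.

(** For [l <= h j] the path from [j] to [l] is nonzero, which kills the coefficient at [l]; longer
    paths factor through [(h j).+1]. For [h j = n] the generator [npath k n.+1] is 0. *)
Lemma npath_ker j k x : (j <= k <= n)%N -> (k <= (h j).+1)%N ->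
  npath k k * x = x -> npath j k * x = 0 -> exists y, x = npath k (h j).+1 * y.
Proof.
move=> /andP[jk kn] khj kx jkx; have le_jn := leq_trans jk kn.
apply: mulr_exists_components => l le_ln.
have [c xl] := npath_row kn le_ln kx; rewrite xl.
have [lk | kl] := ltnP l k.
  by exists 0; rewrite mulr0 npath0 ?scaler0 //; lia.
have [lh | hl] := leqP l (h j); last first.
  by exists (c *: npath (h j).+1 l); rewrite -scalerAr npath_comp //; lia.
exists 0; rewrite mulr0 (@npath_scale_eq0 c j l) ?scale0r //; first by lia.
have : npath j k * x * npath l l = 0 by rewrite jkx mul0r.
by rewrite -mulrA xl -scalerAr npath_comp // jk.
Qed.

(** * The simple module at a vertex [i < n] *)

Section SimpleAt.
Variable i : 'I_n.+1.
Hypothesis lt_in : (i < n)%N.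
Let S := simple_rmod A i.
Let r := (h i).+1.

Let le_in : (i <= n)%N. Proof. exact: ltnW. Qed.

Lemma simple_char_ker x : npath i i * x = x -> simple_char i x = 0 ->
  exists y, x = npath i i.+1 * y.
Proof.
move=> ix sx; apply: mulr_exists_components => l le_ln.
have [c xl] := npath_row le_in le_ln ix; rewrite xl.
have [li | il | liE] := ltngtP l i.
- by exists 0; rewrite mulr0 npath0 ?scaler0 //; lia.
- by exists (c *: npath i.+1 l); rewrite -scalerAr npath_comp //; lia.
exists 0; rewrite mulr0 liE.
have := congr1 (simple_char i) xl; rewrite simple_charM sx mul0r liE.
rewrite simple_charZ simple_char_npath // eqxx mulr1 => <-.
by rewrite scale0r.
Qed.

(** A nonzero path from [j] to [i] can be prolonged to [i.+1] unless [h j = i]. This gives the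
    vanishing of [Hom(S_i, A)]. *)
Lemma socle_free_inj a : (forall j, (j <= n)%N -> h j <> i) ->
  a * npath i i = a -> a * npath i i.+1 = 0 -> a = 0.
Proof.
move=> hi ai a0; apply: npath_eq0_components => j le_jn.
have [c aj] := npath_col le_jn le_in ai; rewrite aj.
have [ij | ji] := ltnP i j; first by rewrite npath0 ?scaler0 //; lia.
have [hj | ihj] := ltnP (h j) i; first by rewrite npath_beyond ?scaler0.
have ihj' : (i < h j)%N by have := hi j le_jn; lia.
rewrite (@npath_scale_eq0 c j i.+1) ?scale0r //; first by lia.
have : npath j j * (a * npath i i.+1) = 0 by rewrite a0 mulr0.
by rewrite mulrA aj -scalerAl npath_comp //; lia.
Qed.

(** A path ending at [i.+1] is lazy or ends with the arrow from [i]. *)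
Lemma col_split a : a * npath i.+1 i.+1 = a ->
  exists c, exists2 y, y * npath i i = y & a = c *: npath i.+1 i.+1 + y * npath i i.+1.
Proof.
move=> ai; have [c cE] := npath_col lt_in lt_in ai.
have [y yE] : exists y, a - c *: npath i.+1 i.+1 = y * npath i i.+1.
  apply: mull_exists_components => j le_jn; rewrite mulrBr -scalerAr.
  have [d dE] := npath_col le_jn lt_in ai; rewrite dE npathM //.
  have [ji | ij | jE] := ltngtP j i.+1.
  - by rewrite scaler0 subr0; exists (d *: npath j i); rewrite -scalerAl npath_comp //; lia.
  - by exists 0; rewrite mul0r npath0 ?scaler0 ?subr0 //; lia.
  by exists 0; rewrite jE in dE *; rewrite /= !leqnn mul0r -dE -cE subrr.
exists c, (y * npath i i); first by rewrite -mulrA npath_idem.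
by rewrite -mulrA npath_left // -yE addrC subrK.
Qed.

(** Paths from [j <= i] to [i.+2] vanish because [h j <= h i = i.+1], so only the lazy path and the
    arrow into [i.+2] remain. *)
Lemma col_split2 a : h i = i.+1 -> (i.+2 <= n)%N -> a * npath i.+2 i.+2 = a ->
  exists c, exists d, a = c *: npath i.+2 i.+2 + d *: npath i.+1 i.+2.
Proof.
move=> hi lt_i1n ai; have [c cE] := npath_col lt_i1n lt_i1n ai.
have [d dE] := npath_col lt_in lt_i1n ai.
exists c, d; apply/eqP; rewrite -subr_eq0; apply/eqP.
apply: npath_eq0_components => j le_jn; rewrite mulrBr mulrDr -!scalerAr !npathM //.
have [j2 | jn2] := eqVneq j i.+2.
  by rewrite j2 leqnn (_ : i.+2 == i.+1 = false) /= ?scaler0 ?addr0 ?cE ?subrr //; lia.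
rewrite /= scaler0 add0r; have [j1 | jn1] := eqVneq j i.+1.
  by rewrite j1 leqnn leqW //= dE subrr.
rewrite /= scaler0 subr0; have [b ->] := npath_col le_jn lt_i1n ai.
have [ij | ji] := ltnP i j; first by rewrite npath0 ?scaler0 //; lia.
rewrite npath_beyond ?scaler0 // ltnS (leq_trans (@h_mono j i _)) ?hi //.
by rewrite ji.
Qed.

Definition simple_aug : 'Hom(principal (npath i i), S) := from_gen (npath i i) (1 : S).

Lemma simple_augE x : simple_aug x = simple_char i (principal_val x).
Proof. by rewrite /simple_aug from_genE; exact: mul1r. Qed.

Lemma simple_aug_hom : simple_aug \in homA (principal (npath i i)) S.
Proof. exact: from_gen_hom. Qed.

Lemma simple_aug_gen : simple_aug (principal_gen (npath i i)) = 1.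
Proof. by rewrite simple_augE principal_genE ?npath_idem // simple_char_npath // eqxx. Qed.

Lemma simple_aug_surj : limg simple_aug = fullv.
Proof.
apply/eqP; rewrite eqEsubv subvf; apply/subvP=> s _; apply/memv_imgP.
exists (s *: principal_gen (npath i i)); rewrite ?memvf // linearZ /= simple_aug_gen.
exact: (esym (mulr1 (s : F))).
Qed.

Let d0 := principal_map (npath i i) (npath i.+1 i.+1) (npath i i.+1).

Lemma simple_aug_exact : limg d0 = lker simple_aug.
Proof.
have leftE : npath i i * npath i i.+1 = npath i i.+1 by exact: npath_left.
have rightE : npath i i.+1 * npath i.+1 i.+1 = npath i i.+1 by exact: npath_right.
have imE := mem_limg_principal_map (npath_idem lt_in) leftE rightE.
apply/vspaceP=> x; rewrite memv_ker simple_augE; apply/idP/eqP => [/imE[y ->]|].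
  by rewrite simple_charM simple_char_npath // eqxx (_ : i.+1 == i = false) ?mul0r //; lia.
case/simple_char_ker; first by rewrite principal_valP ?npath_idem.
by move=> y xE; apply/imE; exists y.
Qed.

Lemma npath_brick k x : (k <= n)%N -> exists c, npath k k * x * npath k k = c *: npath k k.
Proof. by move=> le_kn; exact: npath_corner. Qed.

(** * Comparison with an arbitrary projective resolution of [S_i] *)

Section Compare.
Variable Q : proj_resolution S.

Lemma compare0 :
  exists f : 'Hom(principal (npath i i), Q 0), exists g : 'Hom(Q 0, principal (npath i i)),
  [/\ f \in homA (principal (npath i i)) (Q 0), g \in homA (Q 0) (principal (npath i i)),
      (res_aug Q \o f = simple_aug)%VF, (simple_aug \o g = res_aug Q)%VF & (g \o f = \1)%VF].
Proof.
have idm := npath_idem le_in.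
have [|||f [g [Hf Hg fE gE gf]]] := comparison_step (principal_projective idm)
  (@res_projective _ _ _ Q 0) simple_aug_hom (res_aug_hom Q) (homA_id S) (homA_id S)
  (comp_lfun1l _) _ _ (principal_rigid idm (fun x => npath_brick x le_in) simple_aug_hom _).
- by rewrite comp_lfun1l res_aug_surj subvf.
- by rewrite comp_lfun1l simple_aug_surj subvf.
- by rewrite simple_aug_gen oner_eq0.
by exists f, g; split=> //; rewrite ?fE ?gE comp_lfun1l.
Qed.

Let P0 := principal (npath i i).
Let P1 := principal (npath i.+1 i.+1).

Let d0_gen : d0 (principal_gen (npath i.+1 i.+1)) != 0.
Proof.
rewrite principal_eq0 principal_map_gen ?npath_idem ?npath_left ?npath_right //.
by rewrite hP ?leqnSn // h_gt.
Qed.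

Lemma compare1 :
  exists f0 : 'Hom(P0, Q 0), exists f1 : 'Hom(P1, Q 1), exists g1 : 'Hom(Q 1, P1),
  exists g0 : 'Hom(Q 0, P0),
  [/\ f1 \in homA P1 (Q 1), g1 \in homA (Q 1) P1,
      (res_diff Q 0 \o f1 = f0 \o d0)%VF, (d0 \o g1 = g0 \o res_diff Q 0)%VF
    & (g1 \o f1 = \1)%VF].
Proof.
have [f0 [g0 [Hf0 Hg0 f0E g0E gf0]]] := compare0.
have idm := npath_idem lt_in.
have Hd0 : d0 \in homA P1 P0 := principal_map_hom _ _ _.
have rig := principal_rigid idm (fun x => npath_brick x lt_in) Hd0 d0_gen.
have f0E' : (res_aug Q \o f0 = \1 \o simple_aug)%VF by rewrite f0E comp_lfun1l.
have g0E' : (simple_aug \o g0 = \1 \o res_aug Q)%VF by rewrite g0E comp_lfun1l.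
have [f1 [g1 [Hf Hg fE gE gf]]] := comparison_next (principal_projective idm)
  (@res_projective _ _ _ Q 1) Hd0 (res_diff_hom Q 0) Hf0 Hg0 gf0 f0E' g0E'
  simple_aug_exact (res_exact0 Q) rig.
by exists f0, f1, g1, g0.
Qed.

(** With [Q 1 = 0] the augmentation of [Q] is injective, so [f0] kills the nonzero image of [d0],
    although [g0 \o f0] is the identity. *)
Lemma pd_gt0 : \dim {: Q 1} <> 0%N.
Proof.
move=> Q1; have [f0 [g0 [_ _ f0E _ gf0]]] := compare0.
have f0z : f0 (d0 (principal_gen (npath i.+1 i.+1))) = 0.
  apply/eqP; rewrite -memv0 -(limg_dim0 (res_diff Q 0) Q1) res_exact0 memv_ker.
  by rewrite -[res_aug Q _]comp_lfunE f0E -memv_ker -simple_aug_exact memv_img ?memvf.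
have /lfunP/(_ (d0 (principal_gen (npath i.+1 i.+1)))) := gf0.
by rewrite comp_lfunE f0z linear0 id_lfunE => /esym/eqP; rewrite (negPf d0_gen).
Qed.

Lemma pd_le1_inj z : \dim {: Q 2} = 0%N -> d0 z = 0 -> z = 0.
Proof.
move=> Q2 dz; have [f0 [f1 [g1 [g0 [_ _ f1E _ gf1]]]]] := compare1.
have f1z : f1 z = 0.
  apply/eqP; rewrite -memv0 -(limg_dim0 (res_diff Q 1) Q2) res_exact memv_ker.
  by rewrite -[res_diff Q 0 _]comp_lfunE f1E comp_lfunE dz linear0.
by have /lfunP/(_ z) := gf1; rewrite comp_lfunE f1z linear0 id_lfunE.
Qed.

(** * The case [h i < h i.+1], where the minimal resolution has a second term [e_r A] *)

Section PdGt1.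
Hypothesis h_lt : (h i < h i.+1)%N.

Let r_le : (r <= n)%N.
Proof. by rewrite (leq_trans h_lt) ?h_le. Qed.

Let r_gt : (i.+1 < r)%N.
Proof. by rewrite ltnS h_gt. Qed.

Let P2 := principal (npath r r).
Let d1 := principal_map (npath i.+1 i.+1) (npath r r) (npath i.+1 r).

Lemma npath_r_neq0 : npath i.+1 r != 0.
Proof. by rewrite hP // (ltnW r_gt). Qed.

Let d1_gen : principal_val (d1 (principal_gen (npath r r))) = npath i.+1 r.
Proof. by rewrite principal_map_gen ?npath_idem ?npath_left ?npath_right. Qed.

Lemma simple_exact1 : limg d1 = lker d0.
Proof.
have leftE : npath i.+1 i.+1 * npath i.+1 r = npath i.+1 r by exact: npath_left.
have rightE : npath i.+1 r * npath r r = npath i.+1 r by exact: npath_right.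
have left0E : npath i i * npath i i.+1 = npath i i.+1 by exact: npath_left.
have imE := mem_limg_principal_map (npath_idem r_le) leftE rightE.
apply/vspaceP=> x; rewrite mem_lker_principal_map //; apply/idP/eqP => [/imE[y ->]|].
  by rewrite mulrA npath_comp ?npath_beyond ?mul0r //; lia.
case/npath_ker; rewrite ?principal_valP ?npath_idem ?leqnSn //; first exact: ltnW.
by move=> y xE; apply/imE; exists y.
Qed.

Lemma not_pd_le1 : \dim {: Q 2} <> 0%N.
Proof.
move=> Q2; have : d1 (principal_gen (npath r r)) = 0.
  apply: pd_le1_inj => //; apply/eqP.
  by rewrite -memv_ker -simple_exact1 memv_img ?memvf.
by move/eqP; rewrite principal_eq0 d1_gen (negPf npath_r_neq0).
Qed.

Lemma compare2 :
  exists f1 : 'Hom(P1, Q 1), exists f2 : 'Hom(P2, Q 2), exists g2 : 'Hom(Q 2, P2),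
  exists g1 : 'Hom(Q 1, P1),
  [/\ f1 \in homA P1 (Q 1), f2 \in homA P2 (Q 2), g2 \in homA (Q 2) P2 &
   [/\ (res_diff Q 1 \o f2 = f1 \o d1)%VF, (d1 \o g2 = g1 \o res_diff Q 1)%VF
    & (g2 \o f2 = \1)%VF]].
Proof.
have [f0 [f1 [g1 [g0 [Hf1 Hg1 f1E g1E gf1]]]]] := compare1.
have idm := npath_idem r_le.
have Hd1 : d1 \in homA P2 P1 := principal_map_hom _ _ _.
have d1n0 : d1 (principal_gen (npath r r)) != 0.
  by rewrite principal_eq0 d1_gen npath_r_neq0.
have rig := principal_rigid idm (fun x => npath_brick x r_le) Hd1 d1n0.
have [f2 [g2 [Hf Hg fE gE gf]]] := comparison_next (principal_projective idm)
  (@res_projective _ _ _ Q 2) Hd1 (res_diff_hom Q 1) Hf1 Hg1 gf1 f1E g1E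
  simple_exact1 (res_exact Q 0) rig.
by exists f1, f2, g2, g1.
Qed.

Lemma pd_le2_inj z : \dim {: Q 3} = 0%N -> d1 z = 0 -> z = 0.
Proof.
move=> Q3 dz; have [f1 [f2 [g2 [g1 [_ _ _ [f2E _ gf2]]]]]] := compare2.
have f2z : f2 z = 0.
  apply/eqP; rewrite -memv0 -(limg_dim0 (res_diff Q 2) Q3) res_exact memv_ker.
  by rewrite -[res_diff Q 1 _]comp_lfunE f2E comp_lfunE dz linear0.
by have /lfunP/(_ z) := gf2; rewrite comp_lfunE f2z linear0 id_lfunE.
Qed.

Lemma pd_le2_height : \dim {: Q 3} = 0%N -> h r = h i.+1.
Proof.
move=> Q3; apply/eqP; rewrite eqn_leq andbC h_mono ?(ltnW r_gt) //=.
(* [s] is the first vertex beyond the reach of [i.+1]; the path from [r] to [s] would be a nonzero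
   element killed by [d1]. *)
rewrite leqNgt; apply/negP=> hr; set s := (h i.+1).+1.
have rs : (r <= s)%N by rewrite /s /r; lia.
have sn : (s <= n)%N by rewrite (leq_trans hr) ?h_le.
have z0 : npath r s != 0 by rewrite hP ?rs.
have zE : principal_val (principal_in (npath r r) (npath r s)) = npath r s.
  by rewrite principal_inK ?npath_left.
case/negP: z0; rewrite -zE -principal_eq0; apply/eqP/pd_le2_inj => //.
apply/eqP; rewrite principal_eq0 principal_mapE ?npath_left // zE.
by rewrite npath_comp ?npath_beyond // (ltnW r_gt).
Qed.

(** If [r > i.+2], the lazy path at [r] and the path from [r.-1] to [r] yield classes independent
    modulo coboundaries, so Ext^2 would have dimension at least two. *)
Lemma ext2_height : h r = h i.+1 -> cohom_dim (regular_rmod A) Q 2 = 1%N -> r = i.+2.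
Proof.
move=> hr ext2; have [//| rn] := eqVneq r i.+2.
have r2 : (i.+1 < r.-1)%N by lia.
have r1n : (r.-1 <= n)%N by lia.
have [f1 [f2 [g2 [g1 [Hf1 Hf2 Hg2 [f2E g2E gf2]]]]]] := compare2.
have d1_inj z : d1 z = 0 -> z = 0.
  move/eqP; rewrite principal_eq0 principal_mapE ?npath_left // => /eqP.
  case/npath_ker; rewrite ?principal_valP ?npath_idem ?(ltnW r_gt) ?hr //; first by lia.
  by move=> y zE; apply/eqP; rewrite principal_eq0 zE npath_beyond ?mul0r // hr.
pose R : rmod A := regular_rmod A.
pose Phi (a : A) : 'Hom(Q 2, R) := (from_gen (npath r r) (a : R) \o g2)%VF.
(* [d1] is injective and [d1 \o g2] equals [g1 \o res_diff Q 1], which kills boundaries; hence so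
   does [g2]. *)
have PhiZ a : Phi a \in cocycles R Q 2.
  rewrite /cocycles memv_cap homA_comp ?from_gen_hom // andTb memv_ker (codiffE (P := Q)).
  apply/eqP/lfunP=> x; rewrite zero_lfunE !comp_lfunE (_ : g2 _ = 0) ?linear0 //.
  apply: d1_inj; rewrite -[d1 _]comp_lfunE g2E comp_lfunE (_ : res_diff Q 1 _ = 0) ?linear0 //.
  by apply/eqP; rewrite -memv_ker -res_exact memv_img ?memvf.
have PhiB c d : c *: Phi (npath r r) + d *: Phi (npath r.-1 r) \in coboundaries R Q 2 ->
    c = 0 /\ d = 0.
  (* Evaluation at the [f2]-image of the generator undoes [g2]; the coboundary becomes
     [y * npath i.+1 r] with [y] in [A e_(i+1)]. *)
  case/memv_imgP=> psi Hpsi; rewrite (codiffE (P := Q)).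
  move=> /lfunP/(_ (f2 (principal_gen (npath r r)))).
  rewrite add_lfunE !scale_lfunE !comp_lfunE.
  have /lfunP/(_ (principal_gen (npath r r))) := gf2; rewrite comp_lfunE id_lfunE => ->.
  have /lfunP/(_ (principal_gen (npath r r))) := f2E; rewrite !comp_lfunE => ->.
  have Hpf : (psi \o f1)%VF \in homA P1 R by exact: homA_comp.
  rewrite -[psi _]comp_lfunE (homA_genE (npath_idem lt_in) _ Hpf) d1_gen.
  rewrite !from_gen_gen ?npath_idem //; move: (homA_gen_fix (npath_idem lt_in) Hpf).
  set y := (X in ract X _ = X -> _); rewrite -[y]/(y : A) => ye yE.
  have {}ye : (y : A) * npath i.+1 i.+1 = y := ye.
  have {}yE : c *: npath r r + d *: npath r.-1 r = y * npath i.+1 r.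
    move: yE; rewrite -[ract (npath r r : R) _]/(npath r r * npath r r).
    rewrite -[ract (npath r.-1 r : R) _]/(npath r.-1 r * npath r r).
    by rewrite npath_idem // npath_right.
  (* No path leads from [k > i.+1] back to [i.+1], so the lazy path at [k] kills the coboundary
     value; [k = r] and [k = r.-1] isolate [c] and [d]. *)
  have left_kill k : (i.+1 < k <= n)%N -> npath k k * (y * npath i.+1 r) = 0.
    case/andP=> ik le_kn; have [b bE] := npath_col le_kn lt_in ye.
    by rewrite mulrA bE npath0 ?scaler0 ?mul0r //; lia.
  have rr1 : (r.-1 == r) = false by lia.
  split.
    have := left_kill r; rewrite r_gt r_le -yE mulrDr -!scalerAr npath_idem //.
    rewrite npathM // [r == _]eq_sym rr1 scaler0 addr0 => /(_ isT) /eqP.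
    by rewrite scaler_eq0 (negPf (npath_id_neq0 r_le)) orbF => /eqP.
  have := left_kill r.-1; rewrite r2 r1n -yE mulrDr -!scalerAr npathM // rr1 scaler0 add0r.
  rewrite npath_left // => /(_ isT); apply: npath_scale_eq0; first by lia.
  by rewrite (leq_trans h_lt) // h_mono // (ltnW r2) r1n.
have Phi1 : Phi (npath r r) \notin coboundaries R Q 2.
  apply/negP=> Phi1; have [] := PhiB 1 0; last by move/eqP; rewrite oner_eq0.
  by rewrite scale1r scale0r addr0.
have Phi2 : Phi (npath r.-1 r) \notin (coboundaries R Q 2 + <[Phi (npath r r)]>)%VS.
  apply/negP=> /memv_addP[b bB [w /vlineP[c ->] E]].
  have [] := PhiB (- c) 1; last by move=> _ /eqP; rewrite oner_eq0.
  by rewrite scale1r E addrCA scaleNr addNr addr0.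
have : (coboundaries R Q 2 + <[Phi (npath r r)]> + <[Phi (npath r.-1 r)]> <=
    cocycles R Q 2)%VS.
  rewrite !subv_add -!memvE !PhiZ !andbT; apply/subvP=> _ /memv_imgP[psi Hpsi ->].
  rewrite /cocycles memv_cap !(codiffE (P := Q)) homA_comp ?res_diff_hom // andTb.
  rewrite memv_ker (codiffE (P := Q)).
  apply/eqP/lfunP=> x; rewrite zero_lfunE !comp_lfunE (_ : res_diff Q 1 _ = 0) ?linear0 //.
  by apply/eqP; rewrite -memv_ker -res_exact memv_img ?memvf.
move/dimvS; rewrite !dim_add_line //; move: ext2; rewrite /cohom_dim -/R.
by move=> E le; exfalso; lia.
Qed.
End PdGt1.

(** If [h j = i], the path from [j] to [i] cannot be prolonged and spans a copy of [S_i] in [A];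
    composing this embedding with the augmentation gives a nonzero cocycle. *)
Lemma ext0_socle : cohom_dim (regular_rmod A) Q 0 = 0%N ->
  forall j, (j <= n)%N -> h j <> i.
Proof.
move=> ext0 j le_jn hj; pose R : rmod A := regular_rmod A.
have ji : (j <= i)%N.
  rewrite leqNgt; apply/negP=> ij; have := h_mono (i := i) (j := j).
  by have := h_gt lt_in; rewrite hj (ltnW ij) le_jn; lia.
have nz : npath j i != 0 by rewrite hP ?ji ?hj.
have act a : npath j i * a = simple_char i a *: npath j i.
  have [c cE] := npath_corner a le_in le_in.
  have -> : simple_char i a = c.
    have := congr1 (simple_char i) cE; rewrite !simple_charM simple_charZ.
    by rewrite simple_char_npath // eqxx !mulr1 mul1r.
  rewrite [LHS]npath_sumr (bigD1 i) //= big1 ?addr0 => [|l li].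
    rewrite -(npath_right le_jn le_in) -2!mulrA (mulrA (npath i i)) cE -scalerAr.
    by rewrite npath_right.
  have le_ln : (l <= n)%N by rewrite -ltnS.
  have [d dE] := npath_corner a le_in le_ln.
  rewrite -(npath_right le_jn le_in) -2!mulrA (mulrA (npath i i)) dE -scalerAr npathM //.
  rewrite eqxx ji /=; case: leqP => // il; last by rewrite scaler0.
  by rewrite npath_beyond ?scaler0 // hj ltn_neqAle il andbT eq_sym.
pose sigma : 'Hom(S, R) := linfun (fun s : S => (s : F) *: npath j i : R).
have sigmaE s : sigma s = (s : F) *: npath j i.
  by rewrite linfunE // => c u v; rewrite scalerDl scalerA.
have Hsigma : sigma \in homA S R.
  apply/mem_homA=> s a; rewrite !sigmaE.
  rewrite -[ract (_ *: _ : R) a]/((s : F) *: npath j i * a) -scalerAl act scalerA.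
  by congr (_ *: _).
have HZ : (sigma \o res_aug Q)%VF \in cocycles R Q 0.
  rewrite /cocycles memv_cap homA_comp ?res_aug_hom // andTb memv_ker (codiffE (P := Q)).
  apply/eqP/lfunP=> x; rewrite zero_lfunE !comp_lfunE (_ : res_aug Q _ = 0) ?linear0 //.
  by apply/eqP; rewrite -memv_ker -res_exact0 memv_img ?memvf.
have /memv_imgP[x _ x1] : (1 : S) \in limg (res_aug Q) by rewrite res_aug_surj memvf.
move: ext0; rewrite /cohom_dim dimv0 subn0 => /eqP; rewrite dimv_eq0 => /eqP Z0.
move: HZ; rewrite Z0 memv0 => /eqP/lfunP/(_ x).
by rewrite comp_lfunE -x1 sigmaE scale1r zero_lfunE => /eqP; rewrite (negPf nz).
Qed.

End Compare.

(** * An explicit resolution of length at most two *)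

Section SimpleResolution.
Variables t q : A.
Hypotheses (t_idem : t * t = t).
Hypotheses (eq : npath i.+1 i.+1 * q = q) (qt : q * t = q).
Hypothesis exact1 : forall x, npath i.+1 i.+1 * x = x ->
  npath i i.+1 * x = 0 <-> exists y, x = q * y.
Hypothesis q_inj : forall x, t * x = x -> q * x = 0 -> x = 0.

(** Taking [t = q = 0] gives length one; [t = npath r r] and [q = npath i.+1 r] give length two. *)
Definition res_e k : A :=
  match k with 0 => npath i i | 1 => npath i.+1 i.+1 | 2 => t | _ => 0 end.

Definition res_p k : A :=
  match k with 0 => npath i i.+1 | 1 => q | _ => 0 end.

Fact res_e_idem k : res_e k * res_e k = res_e k.
Proof. by case: k => [|[|[|k]]] /=; rewrite ?npath_idem ?mulr0. Qed.

Fact res_ep k : res_e k * res_p k = res_p k.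
Proof. by case: k => [|[|[|k]]] /=; rewrite ?npath_left ?mulr0. Qed.

Fact res_pe k : res_p k * res_e k.+1 = res_p k.
Proof. by case: k => [|[|[|k]]] /=; rewrite ?npath_right ?mulr0. Qed.

Fact res_exact_p k x : res_e k.+1 * x = x ->
  res_p k * x = 0 <-> exists y, x = res_p k.+1 * y.
Proof.
case: k => [|[|k]] /= ex; first exact: exact1.
  split=> [/(q_inj ex)-> | [y ->]]; first by exists 0; rewrite mulr0.
  by rewrite mul0r mulr0.
split=> _; last exact: mul0r.
by exists 0; rewrite mulr0 -ex mul0r.
Qed.

Definition simple_res : proj_resolution S :=
  principal_resolution res_e_idem res_ep res_pe simple_aug_hom simple_aug_surj
    simple_aug_exact res_exact_p.

Lemma dim_principal0 : \dim {: principal (0 : A)} = 0%N.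
Proof.
apply/eqP; rewrite dimv_eq0 -subv0; apply/subvP=> x _.
by rewrite (principal0 x) mem0v.
Qed.

Lemma simple_res_pd2 k : (2 < k)%N -> \dim {: simple_res k} = 0%N.
Proof. by case: k => [|[|[|k]]] // _; exact: dim_principal0. Qed.

Lemma simple_res_pd1 k : t = 0 -> (1 < k)%N -> \dim {: simple_res k} = 0%N.
Proof. by case: k => [|[|[|k]]] //= t0 _; rewrite ?t0; exact: dim_principal0. Qed.

Let R : rmod A := regular_rmod A.
Let P1 := principal (npath i.+1 i.+1).
Let cocyclesP := mem_principal_cocycles res_e_idem res_ep res_pe simple_aug_hom
  simple_aug_surj simple_aug_exact res_exact_p.
Let coboundariesP := mem_principal_coboundaries res_e_idem res_ep res_pe simple_aug_hom
  simple_aug_surj simple_aug_exact res_exact_p.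

Lemma simple_res_ext0 : (forall j, (j <= n)%N -> h j <> i) ->
  cohom_dim R simple_res 0 = 0%N.
Proof.
move=> hi; rewrite /cohom_dim dimv0 subn0; apply/eqP; rewrite dimv_eq0 -subv0.
apply/subvP=> f /(@cocyclesP R 0 f)[Hf f0]; rewrite memv0; apply/eqP.
apply: (homA_gen_inj (res_e_idem 0)) => //; first exact: mem0v.
rewrite zero_lfunE; apply: (socle_free_inj hi) => //.
exact: (homA_gen_fix (res_e_idem 0) Hf).
Qed.

(** Equality would make [npath k k] a multiple of [npath k k * m], which lies in the zero corner
    [e_k A e_j]. *)
Lemma gen_not_image j k m : (j < k <= n)%N -> m * npath j j = m ->
  npath k k <> m * npath j k.
Proof.
move=> /andP[jk le_kn] mj E; have le_jn : (j <= n)%N by lia.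
have /eqP := npath_id_neq0 le_kn; apply.
have [c cE] := npath_col le_kn le_jn mj.
rewrite -(npath_idem le_kn) {2}E mulrA cE npath0 ?scaler0 ?mul0r //; lia.
Qed.

(** On generators, the coboundaries are the multiples [y * res_p k]; the last two hypotheses say
    that the class of [res_e k.+1] is nonzero and spans the quotient. *)
Lemma cohom_dim_eq1 k :
  (forall f : 'Hom(simple_res k.+1, R), f \in homA (simple_res k.+1) R ->
     f \in cocycles R simple_res k.+1) ->
  (forall m : A, m * res_e k = m -> res_e k.+1 <> m * res_p k) ->
  (forall a : A, a * res_e k.+1 = a -> exists c, exists2 y, y * res_e k = y &
     a = c *: res_e k.+1 + y * res_p k) ->
  cohom_dim R simple_res k.+1 = 1%N.
Proof.
move=> allZ notB split_a; rewrite /cohom_dim.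
pose phi : 'Hom(simple_res k.+1, R) := from_gen (res_e k.+1) (1 : R).
have Hphi : phi \in homA (simple_res k.+1) R := from_gen_hom _ _.
have phi_gen : phi (principal_gen (res_e k.+1)) = res_e k.+1.
  by rewrite /phi from_gen_gen ?res_e_idem //; exact: mul1r.
suff -> : cocycles R simple_res k.+1 = (coboundaries R simple_res k.+1 + <[phi]>)%VS.
  rewrite dim_add_line ?subSnn //; apply/negP=> /(@coboundariesP R k phi)[_ [m me mE]].
  by apply: (notB m me); rewrite -phi_gen mE.
apply/eqP; rewrite eqEsubv; apply/andP; split; last first.
  rewrite subv_add -memvE allZ // andbT.
  by apply/subvP=> f /(@coboundariesP R k f)[Hf _]; exact: allZ.
apply/subvP=> f; rewrite /cocycles memv_cap => /andP[Hf _].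
have [c [y yk fE]] := split_a _ (homA_gen_fix (res_e_idem k.+1) Hf).
rewrite -(subrK (c *: phi) f) memv_add ?memvZ ?memv_line //.
apply/(@coboundariesP R k (f - c *: phi)); split; first by rewrite rpredB // rpredZ.
exists y => //; rewrite add_lfunE opp_lfunE scale_lfunE phi_gen fE.
by rewrite addrC addKr.
Qed.

Lemma simple_res_ext1 : q = 0 -> cohom_dim R simple_res 1 = 1%N.
Proof.
move=> q0; apply: cohom_dim_eq1 => [f Hf | m me | a ai].
- by apply/(@cocyclesP R 1 f); split=> //=; rewrite q0; exact: mulr0.
- by apply: gen_not_image => //; rewrite ltnSn.
- exact: col_split.
Qed.

Section PdEq2.
Hypotheses (h_lt : (h i < h i.+1)%N) (tE : t = npath r r) (qE : q = npath i.+1 r).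

Let r_le : (r <= n)%N.
Proof. by rewrite (leq_trans h_lt) ?h_le. Qed.

(** By [col_split] a cocycle has value [c *: npath i.+1 i.+1] plus a coboundary value. Multiplying
    by [q] leaves [c] times the nonzero path from [i.+1] to [r], as the path from [i] to [r] is 0;
    so [c = 0]. *)
Lemma simple_res_ext1_eq0 : cohom_dim R simple_res 1 = 0%N.
Proof.
apply/eqP; rewrite /cohom_dim subn_eq0; apply: dimvS; apply/subvP=> f.
case/(@cocyclesP R 1 f) => Hf fq; apply/(@coboundariesP R 0 f); split=> //.
have [c [y yi fE]] := col_split (homA_gen_fix (res_e_idem 1) Hf).
exists y => //; rewrite fE; suff -> : c = 0 by rewrite scale0r add0r.
have : (c *: npath i.+1 i.+1 + y * npath i i.+1) * q = 0 by rewrite -fE.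
rewrite mulrDl -scalerAl eq -mulrA qE npath_comp ?(npath_beyond le_in) ?mulr0 ?addr0 //.
  by apply: npath_scale_eq0; rewrite // r_le ltnW // ltnS h_gt.
by rewrite leqnSn ltnW // ltnS h_gt.
Qed.

Lemma simple_res_ext2 : h i = i.+1 -> cohom_dim R simple_res 2 = 1%N.
Proof.
move=> hi; have rE : r = i.+2 by rewrite /r hi.
apply: cohom_dim_eq1 => [f Hf | m me | a ai] /=.
- by apply/(@cocyclesP R 2 f); split=> //; exact: mulr0.
- by rewrite tE qE; apply: gen_not_image => //; rewrite rE ltnSn -rE.
rewrite /= tE rE in ai; have [|c [d aE]] := col_split2 hi _ ai; first by rewrite -rE.
exists c, (d *: npath i.+1 i.+1); first by rewrite -scalerAl npath_idem.
by rewrite tE qE rE -scalerAl npath_left.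
Qed.

End PdEq2.

End SimpleResolution.

(** The kernel generator from [npath_ker] is the path from [i.+1] to [(h i.+1).+1], which is 0. *)
Lemma pd1_exact x : h i = h i.+1 -> npath i.+1 i.+1 * x = x ->
  npath i i.+1 * x = 0 <-> exists y, x = 0 * y.
Proof.
move=> hi ex; split=> [ix | [y ->]]; last by rewrite mul0r mulr0.
have [||y xE] := npath_ker _ _ ex ix; rewrite ?leqnSn //.
  by rewrite ltnW // ltnS h_gt.
by exists 0; rewrite mulr0 xE npath_beyond ?mul0r // hi.
Qed.

Lemma pd2_exact x : npath i.+1 i.+1 * x = x ->
  npath i i.+1 * x = 0 <-> exists y, x = npath i.+1 r * y.
Proof.
move=> ex; split=> [ix | [y ->]]; last first.
  by rewrite mulrA npath_comp ?(npath_beyond le_in) ?mul0r // leqnSn ltnW // ltnS h_gt.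
apply: npath_ker ex ix; rewrite ?leqnSn //.
by rewrite ltnW // ltnS h_gt.
Qed.

Lemma zero_mul_fix (x : A) : 0 * x = x -> 0 * x = 0 -> x = 0.
Proof. by rewrite mul0r. Qed.

Definition pd1_res (hi : h i = h i.+1) : proj_resolution S :=
  simple_res (mulr0 0) (mulr0 _) (mulr0 0) (fun x => pd1_exact hi) zero_mul_fix.

Lemma regular1P : k_regular 1 S <->
  h i = h i.+1 /\ (forall j, (j <= n)%N -> h j <> i).
Proof.
split=> [[[[Q Q2] _] /(_ 0%N isT)[Q' ext0] _] | [hi hj]].
  split; last exact: ext0_socle ext0.
  apply/eqP; rewrite eqn_leq h_mono ?leqnSn //= leqNgt; apply/negP=> h_lt.
  exact: (not_pd_le1 h_lt (Q2 2 isT)).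
split; [split | |].
- by exists (pd1_res hi) => k; exact: simple_res_pd1.
- by case=> // _ [Q Q1]; exact: (pd_gt0 (Q1 1 isT)).
- by case=> // _; exists (pd1_res hi); exact: simple_res_ext0.
by exists (pd1_res hi); exact: simple_res_ext1.
Qed.

(** Equality [h i = h i.+1] would give a resolution of length one, so the second term exists; then
    Ext^2 forces [r = i.+2], which turns [h r = h i.+1] into the third condition. *)
Lemma regular2P : k_regular 2 S <->
  [/\ h i = i.+1, (i.+2 <= n)%N, h i.+1 = h i.+2 & forall j, (j <= n)%N -> h j <> i].
Proof.
split=> [[[[Q Q3] pd2] /(_ 0%N isT)[Q0 ext0] [Q2 ext2]] | [hi i2n hh hj]].
  have h_lt : (h i < h i.+1)%N.
    rewrite ltn_neqAle h_mono ?leqnSn // andbT; apply/negP=> /eqP hi.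
    by apply: (pd2 1 isT); exists (pd1_res hi) => k; exact: simple_res_pd1.
  have hr := pd_le2_height h_lt (Q3 3 isT).
  have rE := ext2_height h_lt hr ext2; split; rewrite -?rE ?hr //.
  - by move: rE => [].
  - by rewrite (leq_trans h_lt) ?h_le.
  - exact: ext0_socle ext0.
have rE : r = i.+2 by rewrite /r hi.
have h_lt : (h i < h i.+1)%N by rewrite hi h_gt.
have r_le : (r <= n)%N by rewrite rE.
have inj (x : A) : npath r r * x = x -> npath i.+1 r * x = 0 -> x = 0.
  move=> rx qx; have [||y ->] := npath_ker _ _ rx qx.
  - by rewrite r_le rE leqnSn.
  - by rewrite /r; lia.
  by rewrite npath_beyond ?mul0r // rE -hh.
pose P := simple_res (npath_idem r_le) (npath_left r lt_in) (npath_right lt_in r_le)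
  pd2_exact inj.
split; [split | |].
- by exists P => k; exact: simple_res_pd2.
- case=> [|[]] // _ [Q Qk]; first exact: (pd_gt0 (Qk 1 isT)).
  exact: (not_pd_le1 h_lt (Qk 2 isT)).
- case=> [|[]] // _; exists P; first exact: simple_res_ext0.
  exact: simple_res_ext1_eq0.
by exists P; exact: simple_res_ext2.
Qed.

End SimpleAt.

End LinearNakayama.

Local Close Scope ring_scope.

(** * Heights of the Dyck path of [A] *)

Section DyckHeight.
Variables (F : fieldType) (n : nat) (A : LNakayama F n) (D : dyck n).
Hypothesis AD : is_dyck_path_of A D.
Let h := height (steps D).

Lemma dyck_height_gt i : i < n -> i < h i.
Proof.
move=> lt_in; rewrite /h height_dyck ?(ltnW lt_in) //.
by rewrite col_height_gt ?dyck_cols_balanced ?size_dyck_cols.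
Qed.

Lemma dyck_height_le i : i <= n -> h i <= n.
Proof.
move=> le_in; rewrite /h height_dyck //.
have := col_height_le (dyck_cols_balanced D); rewrite size_dyck_cols; exact.
Qed.

Lemma dyck_height_mono i j : i <= j <= n -> h i <= h j.
Proof.
case/andP=> ij le_jn; rewrite /h !height_dyck ?(leq_trans ij) //.
exact: col_height_mono.
Qed.

Lemma dyck_height_size : h n = n.
Proof.
rewrite /h height_dyck //; have := col_height_size (dyck_cols_balanced D).
by rewrite size_dyck_cols.
Qed.

(** The area is [h i - i + 1], so the bound [j < i + kupisch A i] becomes [j <= h i]; the truncated
    difference needs [i <= h i], an equality at [i = n]. *)
Lemma npath_height i j : i <= j <= n -> (npath A i j != 0%R) = (j <= h i).
Proof.
move=> ijn; have lt_i : i < n.+1 by lia.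
rewrite (npath_neq0 A (i := Ordinal lt_i)) // -AD /area -/h /=.
have ih : i <= h i.
  case: (ltnP i n) => [/dyck_height_gt/ltnW // | ni].
  by have -> : i = n by [lia]; rewrite dyck_height_size.
by rewrite addnA subnKC // addn1 ltnS.
Qed.

End DyckHeight.

(* The quiver of A has the n.+1 vertices 0, ..., n. *)
Theorem theorem3p13 (F : fieldType) (n : nat) :
  exists phi : dyck n -> dyck n,
    bijective phi /\
    forall (A : LNakayama F n) (D : dyck n), is_dyck_path_of A D ->
    forall i : 'I_n.+1, (i < n)%N ->
      (k_regular 1 (simple_rmod A i) <-> one_rise (steps (phi D)) i) /\
      (k_regular 2 (simple_rmod A i) <-> two_hill (steps (phi D)) i).
Proof.
have [phi [phi_bij phiP]] := dyck_rise_hill_bijection n.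
exists phi; split=> // A D AD i lt_in; have [riseP hillP] := phiP D i lt_in.
have hP := npath_height AD; have h_gt := @dyck_height_gt n D.
have h_le := @dyck_height_le n D; have h_mono := @dyck_height_mono n D.
split; first exact: iff_trans (regular1P hP h_gt h_mono h_le lt_in) (iff_sym riseP).
exact: iff_trans (regular2P hP h_gt h_mono h_le lt_in) (iff_sym hillP).
Qed.
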